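(* Let $\mathcal T$ be a rigidly compactly generated tensor triangulated category. If $\mathcal T$ is supportive, the following are true. (1) For any Thomason subset $V\subseteq\operatorname{Spc}\mathcal T^c$ and $T\in\mathcal T$: (a) $T$ is $V$-acyclic if and only if $\operatorname{supp}T\subseteq V$; (b) $T$ is $V$-local if and only if $\operatorname{supp}T\subseteq V^c$; (c) $\mathcal T_V=\{T\in\mathcal T\mid\operatorname{Supp}T\subseteq V\}$. (2) For $S,T\in\mathcal T$, if there exists a Thomason subset $V\subseteq\operatorname{Spc}\mathcal T^c$ such that $\operatorname{supp}S\subseteq V$ and $V\cap\operatorname{supp}T=\emptyset$, then $\operatorname{Hom}_{\mathcal T}(S,T)=0$. (3) For any Thomason subsets $V,U\subseteq\operatorname{Spc}\mathcal T^c$ and $T\in\mathcal T$, $V\cap U^c\cap\operatorname{supp}T=\emptyset$ if and only if $\Gamma_VL_UT=0$. (4) For any $\mathcal X\subseteq\mathcal T$, let $\operatorname{loc}^\otimes\mathcal X$ be the localising tensor ideal closure of $\mathcal X$. Then $$\operatorname{supp}\operatorname{loc}^\otimes\mathcal X=\overline{\operatorname{supp}\mathcal X},$$ where the closure is taken in the localising topology. In particular, for any set $\{T_\alpha\}\subseteq\mathcal T$, $\operatorname{supp}\coprod T_\alpha=\overline{\bigcup\operatorname{supp}T_\alpha}$. (5) For any closed set $X\subseteq\operatorname{Lspc}\mathcal T$, the category $\{T\in\mathcal T\mid\operatorname{supp}T\subseteq X\}$ is localising.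
   Context: Setting. A rigidly compactly generated tensor triangulated category $\mathcal T$ is a compactly generated triangulated category with set-indexed coproducts and a closed symmetric monoidal product $\otimes$, exact and coproduct-preserving in each variable, with compact unit $1$, such that the full subcategory $\mathcal T^c$ of compact objects is essentially small, closed under $\otimes$, and rigid (every compact object is strongly dualisable). $\operatorname{Spc}\mathcal T^c$ is the Balmer spectrum: the set of prime thick tensor ideals of $\mathcal T^c$, with the weakest topology in which $\operatorname{Supp}C=\{\text{primes not containing }C\}$ is closed for every $C\in\mathcal T^c$. It is a spectral space. For points write $\mathfrak p\subseteq\mathfrak q$ if $\mathfrak q\in\overline{\{\mathfrak p\}}$ (not the inclusion of thick ideals). A subset is Thomason if it is a union of complements of quasi-compact open sets. $(-)^c$ applied to a subset denotes its complement. A localising subcategory is a thick (triangulated, closed under summands) subcategory closed under set-indexed coproducts; it is a tensor ideal if closed under $\otimes$ with arbitrary objects of $\mathcal T$. For a Thomason subset $V$, $\mathcal T_V$ is the localising subcategory of $\mathcal T$ generated by the compact objects $C$ with $\operatorname{Supp}C\subseteq V$; $T$ is $V$-acyclic if $T\in\mathcal T_V$ and $V$-local if $\operatorname{Hom}_{\mathcal T}(\mathcal T_V,T)=0$. There are coproduct-preserving exact functors $\Gamma_V,L_V\colon\mathcal T\to\mathcal T$ and functorial exact triangles $\Gamma_VT\to T\to L_VT\to$ with $\Gamma_VT\in\mathcal T_V$ and $L_VT$ $V$-local. For $\mathfrak p\in\operatorname{Spc}\mathcal T^c$, $Z(\mathfrak p)=\{\mathfrak q\mid\mathfrak q\nsubseteq\mathfrak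 p\}$ is the largest Thomason subset not containing $\mathfrak p$; put $T_{\mathfrak p}=L_{Z(\mathfrak p)}T$ and $\operatorname{Supp}T=\{\mathfrak p\mid T_{\mathfrak p}\ne0\}$. Definition. $\mathfrak p\in\operatorname{supp}T$ if $\Gamma_VL_UT\neq0$ for all Thomason subsets $V,U$ with $\mathfrak p\in V\cap U^c$. For a class $\mathcal X$ of objects, $\operatorname{supp}\mathcal X=\bigcup_{T\in\mathcal X}\operatorname{supp}T$. $\operatorname{Lspc}\mathcal T$ is the set $\operatorname{Spc}\mathcal T^c$ with the localising topology, generated by the sets $V\cap U^c$ with $V,U$ Thomason. $\mathcal T$ is supportive if for all $T\in\mathcal T$: $\operatorname{supp}T=\emptyset$ if and only if $T=0$. *)

(* Defs.v *)
From HB Require Import structures.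
From Stdlib Require List.
From mathcomp Require Export all_boot all_order all_algebra.
From mathcomp Require Export finmap all_classical.
From mathcomp Require Export topology.

Set Implicit Arguments.
Unset Strict Implicit.
Unset Printing Implicit Defensive.

Import GRing.Theory.
Local Open Scope classical_set_scope.
Local Open Scope ring_scope.

(* "Sets", as opposed to classes: hom-sets and index sets of coproducts live in
   this universe, while the objects of a category may live in a larger one. *)
Definition SmallType := Type.

(* The carrier of a hom-group is kept apart from its zmodType structure: a field
   of type ob -> ob -> zmodType would not force hom-sets to be small. *)
Record quiver := Quiver {
  ob :> Type;
  hom_sort : ob -> ob -> SmallType;
  hom_class : forall X Y, GRing.Zmodule (hom_sort X Y) }.

Definition hom (Q : quiver) (X Y : Q) : zmodType :=
  GRing.Zmodule.Pack (hom_class X Y).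

Record preadditive := Preadditive {
  quiver_of :> quiver;
  idm : forall X : quiver_of, hom X X;
  comp : forall X Y Z : quiver_of, hom Y Z -> hom X Y -> hom X Z;
  comp1m : forall X Y (f : hom X Y), comp (idm Y) f = f;
  compm1 : forall X Y (f : hom X Y), comp f (idm X) = f;
  compA : forall X Y Z W (h : hom Z W) (g : hom Y Z) (f : hom X Y),
    comp h (comp g f) = comp (comp h g) f;
  compDl : forall X Y Z (g g' : hom Y Z) (f : hom X Y),
    comp (g + g') f = comp g f + comp g' f;
  compDr : forall X Y Z (g : hom Y Z) (f f' : hom X Y),
    comp g (f + f') = comp g f + comp g f' }.

Arguments idm {_} X.
Arguments comp {_ X Y Z} g f.
Notation "g \c f" := (comp g f) (at level 40, left associativity).

Section Preadditive.
Variable C : preadditive.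
Implicit Types X Y Z : C.

Definition is_iso X Y (f : hom X Y) :=
  exists g : hom Y X, g \c f = idm X /\ f \c g = idm Y.

Definition isomorphic X Y := exists f : hom X Y, is_iso f.

Definition is_zero X :=
  forall Y, (forall f : hom X Y, f = 0) /\ (forall f : hom Y X, f = 0).

Definition is_biproduct X Y P (i1 : hom X P) (i2 : hom Y P)
    (p1 : hom P X) (p2 : hom P Y) :=
  [/\ p1 \c i1 = idm X, p2 \c i2 = idm Y, p2 \c i1 = 0, p1 \c i2 = 0
    & i1 \c p1 + i2 \c p2 = idm P].

Definition is_summand X P :=
  exists Y (i1 : hom X P) (i2 : hom Y P) (p1 : hom P X) (p2 : hom P Y),
    is_biproduct i1 i2 p1 p2.

Definition is_coproduct (I : SmallType) (X : I -> C) P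
    (inj : forall i, hom (X i) P) :=
  forall Y (f : forall i, hom (X i) Y),
    exists! h : hom P Y, forall i, h \c inj i = f i.

(* The canonical map \bigoplus_i Hom(A, X_i) -> Hom(A, \coprod_i X_i) is
   bijective for every small coproduct. *)
Definition compact_obj (A : C) :=
  forall (I : SmallType) (X : I -> C) P (inj : forall i, hom (X i) P),
    is_coproduct inj -> forall f : hom A P,
    exists! g : forall i, hom A (X i),
      finite_set [set i | g i <> 0] /\
      f = \sum_(i \in [set: {classic I}]) (inj i \c g i).

End Preadditive.

Record endofunctor (C : preadditive) := Endofunctor {
  fob :> C -> C;
  fmor : forall X Y, hom X Y -> hom (fob X) (fob Y);
  fmor1 : forall X, fmor (idm X) = idm (fob X);
  fmorM : forall X Y Z (g : hom Y Z) (f : hom X Y),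
    fmor (g \c f) = fmor g \c fmor f }.

Arguments fmor {C} F {X Y} f : rename.

Section Functors.
Variable C : preadditive.
Implicit Types F G : endofunctor C.

Definition id_functor : endofunctor C :=
  @Endofunctor C id (fun _ _ f => f) (fun _ => erefl) (fun _ _ _ _ _ => erefl).


Fact comp_fmor1 F G X : fmor F (fmor G (idm X)) = idm (F (G X)).
Proof. by rewrite !fmor1. Qed.

Fact comp_fmorM F G X Y Z (g : hom Y Z) (f : hom X Y) :
  fmor F (fmor G (g \c f)) = fmor F (fmor G g) \c fmor F (fmor G f).
Proof. by rewrite !fmorM. Qed.

Definition comp_functor F G : endofunctor C :=
  @Endofunctor C (fun X => F (G X)) (fun _ _ f => fmor F (fmor G f))
    (comp_fmor1 F G) (comp_fmorM F G).

Definition natural F G (a : forall X, hom (F X) (G X)) :=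
  forall X Y (f : hom X Y), a Y \c fmor F f = fmor G f \c a X.

Definition natural_iso F G (a : forall X, hom (F X) (G X)) :=
  natural a /\ forall X, is_iso (a X).

Definition additive_functor F :=
  forall X Y (f g : hom X Y), fmor F (f + g) = fmor F f + fmor F g.

Definition is_equivalence F :=
  exists G (a : forall X, hom (comp_functor F G X) (id_functor X))
           (b : forall X, hom (comp_functor G F X) (id_functor X)),
    natural_iso a /\ natural_iso b.

Definition preserves_coproducts F :=
  forall (I : SmallType) (X : I -> C) P (inj : forall i, hom (X i) P),
    is_coproduct inj -> is_coproduct (fun i => fmor F (inj i)).

End Functors.

Record triangulated := Triangulated {
  preadditive_of :> preadditive;
  has_zero : exists Z : preadditive_of, is_zero Z;
  has_biproducts : forall X Y : preadditive_of,
    exists P (i1 : hom X P) (i2 : hom Y P) (p1 : hom P X) (p2 : hom P Y),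
      is_biproduct i1 i2 p1 p2;
  shift : endofunctor preadditive_of;
  shift_additive : additive_functor shift;
  shift_equivalence : is_equivalence shift;
  dist : forall X Y Z : preadditive_of,
    hom X Y -> hom Y Z -> hom Z (shift X) -> Prop;
  dist_iso : forall X Y Z (f : hom X Y) (g : hom Y Z) (h : hom Z (shift X))
      X' Y' Z' (f' : hom X' Y') (g' : hom Y' Z') (h' : hom Z' (shift X'))
      (a : hom X X') (b : hom Y Y') (c : hom Z Z'),
    is_iso a -> is_iso b -> is_iso c ->
    b \c f = f' \c a -> c \c g = g' \c b -> fmor shift a \c h = h' \c c ->
    dist f g h -> dist f' g' h';
  dist_id : forall X Z, is_zero Z ->
    dist (idm X) (0 : hom X Z) (0 : hom Z (shift X));
  dist_cone : forall X Y (f : hom X Y),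
    exists Z (g : hom Y Z) (h : hom Z (shift X)), dist f g h;
  dist_rotate : forall X Y Z (f : hom X Y) (g : hom Y Z) (h : hom Z (shift X)),
    dist f g h <-> dist g h (- fmor shift f);
  dist_mor : forall X Y Z (f : hom X Y) (g : hom Y Z) (h : hom Z (shift X))
      X' Y' Z' (f' : hom X' Y') (g' : hom Y' Z') (h' : hom Z' (shift X'))
      (a : hom X X') (b : hom Y Y'),
    dist f g h -> dist f' g' h' -> b \c f = f' \c a ->
    exists c : hom Z Z', c \c g = g' \c b /\ fmor shift a \c h = h' \c c;
  dist_octahedral : forall X Y Z (f : hom X Y) (g : hom Y Z)
      X' Y' Z' (f' : hom Y Z') (f'' : hom Z' (shift X))
      (g' : hom Z X') (g'' : hom X' (shift Y))
      (h' : hom Z Y') (h'' : hom Y' (shift X)),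
    dist f f' f'' -> dist g g' g'' -> dist (g \c f) h' h'' ->
    exists (u : hom Z' Y') (v : hom Y' X'),
      [/\ dist u v (fmor shift f' \c g''),
          u \c f' = h' \c g, h'' \c u = f'',
          v \c h' = g' & g'' \c v = fmor shift f \c h''] }.

Arguments shift {_}.
Arguments dist {_ X Y Z} f g h.

Section Triangulated.
Variable T : triangulated.

Definition exact_functor (F : endofunctor T) :=
  additive_functor F /\
  exists phi : forall X, hom (comp_functor F shift X) (comp_functor shift F X),
    natural_iso phi /\
    forall X Y Z (f : hom X Y) (g : hom Y Z) (h : hom Z (shift X)),
      dist f g h -> dist (fmor F f) (fmor F g) (phi X \c fmor F h).

(* Thick subcategories of the full subcategory of T with objects A. *)
Record thick_in (A S : set T) : Prop := ThickIn {
  thick_sub : S `<=` A;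
  thick_zero : forall X, A X -> is_zero X -> S X;
  thick_iso : forall X Y, A Y -> isomorphic X Y -> S X -> S Y;
  thick_shift : forall X, A X -> A (shift X) -> S (shift X) <-> S X;
  thick_cone : forall X Y Z (f : hom X Y) (g : hom Y Z) (h : hom Z (shift X)),
    A Z -> dist f g h -> S X -> S Y -> S Z;
  thick_summand : forall X Y, A X -> is_summand X Y -> S Y -> S X }.

Definition thick (S : set T) := thick_in setT S.

Record localising (S : set T) : Prop := Localising {
  localising_thick : thick S;
  localising_coproduct :
    forall (I : SmallType) (X : I -> T) P (inj : forall i, hom (X i) P),
    is_coproduct inj -> (forall i, S (X i)) -> S P }.

Definition essentially_small (S : set T) :=
  exists (J : SmallType) (E : J -> T),
    forall X, S X -> exists j, isomorphic (E j) X.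

(* A set of compact objects whose shifts, in both directions, detect zero:
   Hom(Sigma^-n G, X) is written Hom(G, Sigma^n X). *)
Definition compactly_generated :=
  exists (J : SmallType) (G : J -> T), (forall j, compact_obj (G j)) /\
    forall X,
      (forall j (n : nat),
        (forall f : hom (iter n shift (G j)) X, f = 0) /\
        (forall f : hom (G j) (iter n shift X), f = 0)) ->
      is_zero X.

End Triangulated.

Record tensor_triangulated := TensorTriangulated {
  tri_of :> triangulated;
  unit_obj : tri_of;
  tensor : tri_of -> tri_of -> tri_of;
  tmor : forall X X' Y Y' : tri_of,
    hom X X' -> hom Y Y' -> hom (tensor X Y) (tensor X' Y');
  tmor1 : forall X Y, tmor (idm X) (idm Y) = idm (tensor X Y);
  tmorM : forall X X' X'' Y Y' Y'' (f' : hom X' X'') (f : hom X X')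
      (g' : hom Y' Y'') (g : hom Y Y'),
    tmor (f' \c f) (g' \c g) = tmor f' g' \c tmor f g;
  assoc : forall X Y Z,
    hom (tensor (tensor X Y) Z) (tensor X (tensor Y Z));
  lunit : forall X, hom (tensor unit_obj X) X;
  runit : forall X, hom (tensor X unit_obj) X;
  braid : forall X Y, hom (tensor X Y) (tensor Y X);
  assoc_iso : forall X Y Z, is_iso (assoc X Y Z);
  lunit_iso : forall X, is_iso (lunit X);
  runit_iso : forall X, is_iso (runit X);
  assoc_natural : forall X X' Y Y' Z Z'
      (f : hom X X') (g : hom Y Y') (h : hom Z Z'),
    assoc X' Y' Z' \c tmor (tmor f g) h = tmor f (tmor g h) \c assoc X Y Z;
  lunit_natural : forall X X' (f : hom X X'),
    lunit X' \c tmor (idm unit_obj) f = f \c lunit X;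
  runit_natural : forall X X' (f : hom X X'),
    runit X' \c tmor f (idm unit_obj) = f \c runit X;
  braid_natural : forall X X' Y Y' (f : hom X X') (g : hom Y Y'),
    braid X' Y' \c tmor f g = tmor g f \c braid X Y;
  pentagon : forall X Y Z W,
    tmor (idm X) (assoc Y Z W) \c assoc X (tensor Y Z) W
      \c tmor (assoc X Y Z) (idm W)
    = assoc X Y (tensor Z W) \c assoc (tensor X Y) Z W;
  unit_triangle : forall X Y,
    tmor (idm X) (lunit Y) \c assoc X unit_obj Y = tmor (runit X) (idm Y);
  hexagon : forall X Y Z,
    assoc Y Z X \c braid X (tensor Y Z) \c assoc X Y Z
    = tmor (idm Y) (braid X Z) \c assoc Y X Z \c tmor (braid X Y) (idm Z);
  braid_sym : forall X Y, braid Y X \c braid X Y = idm (tensor X Y);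
  ihom : tri_of -> tri_of -> tri_of;
  eval : forall X Y, hom (tensor (ihom X Y) X) Y;
  eval_universal : forall X Y Z (f : hom (tensor Z X) Y),
    exists! g : hom Z (ihom X Y), eval X Y \c tmor g (idm X) = f }.

Arguments unit_obj {_}.
Arguments tensor {_} X Y.
Arguments tmor {_ X X' Y Y'} f g.
Arguments assoc {_} X Y Z.
Arguments lunit {_} X.
Arguments runit {_} X.
Arguments braid {_} X Y.
Arguments ihom {_} X Y.
Arguments eval {_} X Y.
Notation "X ⊗ Y" := (tensor X Y) (at level 40, left associativity).

Section TensorTriangulated.
Variable T : tensor_triangulated.

Fact tensorlM (X Y Y' Y'' : T) (g : hom Y' Y'') (f : hom Y Y') :
  tmor (idm X) (g \c f) = tmor (idm X) g \c tmor (idm X) f.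
Proof. by rewrite -tmorM comp1m. Qed.

Definition tensorl (X : T) : endofunctor T :=
  @Endofunctor T (fun Y => X ⊗ Y) (fun _ _ f => tmor (idm X) f)
    (tmor1 X) (@tensorlM X).

Fact tensorrM (X Y Y' Y'' : T) (g : hom Y' Y'') (f : hom Y Y') :
  tmor (g \c f) (idm X) = tmor g (idm X) \c tmor f (idm X).
Proof. by rewrite -tmorM comp1m. Qed.

Definition tensorr (X : T) : endofunctor T :=
  @Endofunctor T (fun Y => Y ⊗ X) (fun _ _ f => tmor f (idm X))
    (fun Y => tmor1 Y X) (@tensorrM X).

(* For all Y, the canonical map nu : Y ⊗ hom(C, 1) -> hom(C, Y), adjoint to
   Y ⊗ hom(C, 1) ⊗ C -> Y ⊗ 1 = Y, is an isomorphism. *)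
Definition strongly_dualisable (C : T) :=
  forall Y, exists2 nu : hom (Y ⊗ ihom C unit_obj) (ihom C Y),
    eval C Y \c tmor nu (idm C)
      = runit Y \c tmor (idm Y) (eval C unit_obj) \c assoc Y (ihom C unit_obj) C
    & is_iso nu.

Definition tensor_ideal (S : set T) := forall X Y, S X -> S (Y ⊗ X).

End TensorTriangulated.

Record rcg_tensor_triangulated := RcgTensorTriangulated {
  tt_of :> tensor_triangulated;
  has_coproducts : forall (I : SmallType) (X : I -> tt_of),
    exists P (inj : forall i, hom (X i) P), is_coproduct inj;
  tensorl_exact : forall X : tt_of, exact_functor (tensorl X);
  tensorr_exact : forall X : tt_of, exact_functor (tensorr X);
  tensorl_coproducts : forall X : tt_of, preserves_coproducts (tensorl X);
  tensorr_coproducts : forall X : tt_of, preserves_coproducts (tensorr X);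
  compact_generation : compactly_generated tt_of;
  compact_small : essentially_small (@compact_obj tt_of);
  compact_unit : compact_obj (unit_obj : tt_of);
  compact_tensor : forall C D : tt_of,
    compact_obj C -> compact_obj D -> compact_obj (C ⊗ D);
  compact_rigid : forall C : tt_of, compact_obj C -> strongly_dualisable C }.

Record compact_ideal (T : rcg_tensor_triangulated) (P : set T) : Prop :=
  CompactIdeal {
  ideal_thick : thick_in (@compact_obj T) P;
  ideal_tensor : forall C D, P C -> compact_obj D -> P (D ⊗ C) }.

Record prime_ideal (T : rcg_tensor_triangulated) (P : set T) : Prop :=
  PrimeIdeal {
  prime_is_ideal : compact_ideal P;
  prime_proper : exists2 C : T, compact_obj C & ~ P C;
  prime_prime : forall C D, compact_obj C -> compact_obj D ->
    P (C ⊗ D) -> P C \/ P D }.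

Record Spc (T : rcg_tensor_triangulated) := PrimePoint {
  prime_of : set T;
  prime_ofP : prime_ideal prime_of }.

HB.instance Definition _ (T : rcg_tensor_triangulated) := gen_eqMixin (Spc T).
HB.instance Definition _ (T : rcg_tensor_triangulated) :=
  gen_choiceMixin (Spc T).

(* The support of C; only meant for compact C, for other objects see Supp. *)
Definition csupp (T : rcg_tensor_triangulated) (C : T) : set (Spc T) :=
  [set p : Spc T | ~ prime_of p C].

HB.instance Definition _ (T : rcg_tensor_triangulated) :=
  @isSubBaseTopological.Build (Spc T) (set (Spc T))
    [set ~` csupp C | C in @compact_obj T] id.

Section Spectrum.
Variable T : rcg_tensor_triangulated.

Definition thomason (V : set (Spc T)) :=
  exists2 F : set (set (Spc T)),
    (forall O, F O -> open O /\ compact O) & V = \bigcup_(O in F) ~` O.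

Record thomasonSet := ThomasonSet {
  tset :> set (Spc T);
  tsetP : thomason tset }.

(* p ⊆ q in the order of specialisation, which reverses the inclusion of thick
   ideals. *)
Definition spec_le (p q : Spc T) := closure [set p] q.

Definition Zset (p : Spc T) : set (Spc T) := [set q | ~ spec_le q p].

Lemma isoT (C : preadditive) (X Y Z : C) :
  isomorphic X Y -> isomorphic Y Z -> isomorphic X Z.
Proof.
move=> [f [f' [ff' f'f]]] [g [g' [gg' g'g]]]; exists (g \c f), (f' \c g').
by rewrite -!compA (compA g') gg' comp1m ff' (compA f) f'f comp1m g'g.
Qed.

Lemma isoS (C : preadditive) (X Y : C) : isomorphic X Y -> isomorphic Y X.
Proof. by move=> [f [g [gf fg]]]; exists g, f. Qed.

Lemma fun_iso (C : preadditive) (F : endofunctor C) (X Y : C) :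
  isomorphic X Y -> isomorphic (F X) (F Y).
Proof.
move=> [f [g [gf fg]]]; exists (fmor F f), (fmor F g).
by rewrite -!fmorM gf fg !fmor1.
Qed.

Lemma comp0m (C : preadditive) (X Y Z : C) (f : hom X Y) :
  (0 : hom Y Z) \c f = 0.
Proof. have /eqP := compDl 0 (0 : hom Y Z) f.
by rewrite addr0 -subr_eq0 opprD addrA subrr sub0r oppr_eq0 => /eqP. Qed.

Lemma compm0 (C : preadditive) (X Y Z : C) (f : hom Y Z) :
  f \c (0 : hom X Y) = 0.
Proof. have /eqP := compDr f 0 (0 : hom X Y).
by rewrite addr0 -subr_eq0 opprD addrA subrr sub0r oppr_eq0 => /eqP. Qed.

Lemma id0_zero (C : preadditive) (X : C) : idm X = 0 -> is_zero X.
Proof.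
move=> X0 Y; split=> f; first by rewrite -(compm1 f) X0 compm0.
by rewrite -(comp1m f) X0 comp0m.
Qed.

Lemma fmor0 (C : preadditive) (F : endofunctor C) (X Y : C) :
  additive_functor F -> fmor F (0 : hom X Y) = 0.
Proof.
move=> /(_ _ _ 0 (0 : hom X Y)) /eqP.
by rewrite addr0 -subr_eq0 opprD addrA subrr sub0r oppr_eq0 => /eqP.
Qed.

Lemma fun_zero (C : preadditive) (F : endofunctor C) (X : C) :
  additive_functor F -> is_zero X -> is_zero (F X).
Proof.
by move=> aF zX; apply: id0_zero; rewrite -fmor1 ((zX X).1 (idm X)) fmor0.
Qed.

Lemma fun_summand (C : preadditive) (F : endofunctor C) (X Y : C) :
  additive_functor F -> is_summand X Y -> is_summand (F X) (F Y).
Proof.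
move=> aF [Z [i1 [i2 [p1 [p2 [e1 e2 e3 e4 e5]]]]]]; exists (F Z).
exists (fmor F i1), (fmor F i2), (fmor F p1), (fmor F p2).
by split; rewrite -!fmorM -?aF ?e1 ?e2 ?e3 ?e4 ?e5 ?fmor1 ?fmor0.
Qed.

Lemma compact_iso (C : preadditive) (X Y : C) :
  isomorphic X Y -> compact_obj X -> compact_obj Y.
Proof.
move=> [e [e' [e'e ee']]] cX I A P inj coP f.
have [g [[fg sg] ug]] := cX I A P inj coP (f \c e).
have compS (W Z : C) (h : hom W Z) (G : forall i, hom Z (A i)) :
    finite_set [set i | G i <> 0] ->
    finite_set [set i | G i \c h <> 0] /\
    (\sum_(i \in [set: {classic I}]) (inj i \c G i)) \c h =
    \sum_(i \in [set: {classic I}]) (inj i \c (G i \c h)).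
  move=> fG; split.
    by apply: sub_finite_set fG => i /= Gh G0; apply: Gh; rewrite G0 comp0m.
  set B : set {classic I} := [set i | G i <> 0].
  have out (V : C) (H : forall i : {classic I}, hom V P) :
      (forall i, ~ B i -> H i = 0) ->
      \sum_(i \in [set: {classic I}]) H i = \sum_(i \in B) H i.
    by move=> H0; apply/esym/fsbig_widen => // i [_ /H0].
  rewrite !out; last 2 first.
  - by move=> i /contrapT ->; rewrite ?comp0m compm0.
  - by move=> i /contrapT ->; rewrite ?comp0m compm0.
  rewrite !fsbig_finite//= (big_morph (fun k => k \c h) (id1 := 0) (op1 := +%R)).
  - by apply: eq_bigr => i _; rewrite compA.
  - by move=> a b; rewrite compDl.
  - by rewrite comp0m.
exists (fun i => g i \c e'); split.
  have [? s] := compS _ _ e' g fg; split=> //.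
  by rewrite -s -sg -compA ee' compm1.
move=> g' [fg' sg'].
have [fge s] := compS _ _ e g' fg'.
have -> : g = fun i => g' i \c e by apply: ug; rewrite -s -sg'.
by apply: functional_extensionality_dep => i; rewrite -compA ee' compm1.
Qed.

Lemma ideal_colon (M : set T) (b : T) : compact_ideal M -> compact_obj b ->
  compact_ideal [set x | compact_obj x /\ M (x ⊗ b)].
Proof.
move=> [tM oM] cb; have [aF [phi [[_ iphi] dphi]]] := tensorr_exact b.
have cxb x : compact_obj x -> compact_obj (x ⊗ b) by move/compact_tensor; apply.
split; first split.
- by move=> x [].
- move=> x cx zx; split=> //; apply: (thick_zero tM); first exact: cxb.
  exact: (fun_zero aF zx).
- move=> x y cy xy [cx Mx]; split=> //; apply: (thick_iso tM) Mx.
    exact: cxb.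
  exact: (fun_iso (tensorr b) xy).
- move=> x cx csx.
  have i : isomorphic (shift x ⊗ b) (shift (x ⊗ b)).
    by exists (phi x); exact: iphi.
  have cs : compact_obj (shift (x ⊗ b)) by apply: compact_iso i _; exact: cxb.
  split=> -[_ Mx]; split=> //.
    by apply/(thick_shift tM (cxb _ cx) cs); exact: (thick_iso tM cs i).
  apply: (thick_iso tM (cxb _ csx) (isoS i)).
  by apply/(thick_shift tM (cxb _ cx) cs).
- move=> x y z f g h cz /dphi d [_ Mx] [_ My]; split=> //.
  exact: (thick_cone tM (cxb _ cz) d).
- move=> x y cx xy [_ My]; split=> //.
  exact: (thick_summand tM (cxb _ cx) (fun_summand aF xy)).
- move=> x d [cx Mx] cd; split; first exact: compact_tensor.
  apply: (thick_iso tM _ _ (oM _ _ Mx cd)); first exact/cxb/compact_tensor.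
  by apply: isoS; exists (assoc d x b); exact: assoc_iso.
Qed.

Lemma ideal_sym (M : set T) x y : compact_ideal M ->
  compact_obj x -> compact_obj y -> M (x ⊗ y) -> M (y ⊗ x).
Proof.
move=> [tM _] cx cy; apply: (thick_iso tM); first exact: compact_tensor.
by exists (braid x y), (braid y x); rewrite !braid_sym.
Qed.

Lemma prime_exists (J S : set T) (C : T) : compact_ideal J -> J C ->
  S unit_obj -> S `<=` @compact_obj T ->
  (forall x y, S x -> S y -> S (x ⊗ y)) ->
  J `&` S = set0 -> exists2 p : Spc T, prime_of p C & prime_of p `&` S = set0.
Proof.
move=> iJ JC S1 Sc SM JS.
pose Q (A : set T) := A = set0 \/ [/\ compact_ideal A, A C & A `&` S = set0].
have [F FQ tF|M [QM maxM]] := @Zorn_bigcup _ Q.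
  have [[A FA [c Ac]]|noA] := pselect (exists2 A, F A & A !=set0); last first.
    by left; apply/seteqP; split=> // x [A FA Ax]; apply: noA; exists A => //; exists x.
  have Fi B x : F B -> B x -> [/\ compact_ideal B, B C & B `&` S = set0].
    by move=> FB Bx; case: (FQ B FB) => // B0; move: Bx; rewrite B0.
  right; split; first split; first split.
  - by move=> x [B FB Bx]; case: (Fi B x FB Bx) => -[tB _] _ _; exact: (thick_sub tB).
  - move=> x cx zx; exists A => //; case: (Fi A c FA Ac) => -[tA _] _ _.
    exact: (thick_zero tA).
  - move=> x y cy xy [B FB Bx]; exists B => //.
    by case: (Fi B x FB Bx) => -[tB _] _ _; exact: (thick_iso tB cy xy).
  - move=> x cx csx; split=> -[B FB Bx]; exists B => //;
      case: (Fi B _ FB Bx) => -[tB _] _ _; exact/(thick_shift tB cx csx).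
  - move=> x y z f g h cz d [B FB Bx] [B' FB' By].
    have [sB|sB] := tF B B' FB FB'.
      exists B' => //; case: (Fi B' y FB' By) => -[tB _] _ _.
      exact: (thick_cone tB cz d (sB _ Bx)).
    exists B => //; case: (Fi B x FB Bx) => -[tB _] _ _.
    exact: (thick_cone tB cz d Bx (sB _ By)).
  - move=> x y cx xy [B FB By]; exists B => //.
    by case: (Fi B y FB By) => -[tB _] _ _; exact: (thick_summand tB cx xy).
  - move=> x d [B FB Bx] cd; exists B => //.
    by case: (Fi B x FB Bx) => -[_ oB] _ _; exact: oB.
  - by exists A => //; case: (Fi A c FA Ac).
  - apply/seteqP; split=> // x [[B FB Bx] Sx].
    by case: (Fi B x FB Bx) => _ _ BS; rewrite -[set0 x]/(set0 x) -BS.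
have [iM MC MS] : [/\ compact_ideal M, M C & M `&` S = set0].
  case: QM => // M0; exfalso; apply: (maxM J); last by right.
  by rewrite M0; split=> // JsubM; exact: (JsubM C JC).
have Mbig B x : compact_ideal B -> M `<=` B -> B x -> ~ M x ->
    exists2 s, S s & B s.
  move=> iB MB Bx nMx; apply: contrapT => noS; apply: (maxM B).
    by split=> // BM; apply/nMx/BM.
  right; split=> //; first exact: MB.
  by apply/seteqP; split=> // s [Bs Ss]; apply: noS; exists s.
have cM x : M x -> compact_obj x by case: iM => tM _; exact: (thick_sub tM).
have sub b : compact_obj b -> M `<=` [set x | compact_obj x /\ M (x ⊗ b)].
  move=> cb x Mx; split; first exact: cM.
  by apply: (ideal_sym iM cb (cM _ Mx)); case: iM => _; apply.
suff pM : prime_ideal M by exists (PrimePoint pM).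
split=> //; first exists unit_obj.
- exact: compact_unit.
- by move=> M1; have : set0 (unit_obj : T) by rewrite -MS.
move=> a b ca cb Mab; apply: contrapT => /not_orP[nMa nMb].
have [s Ss [cs Msb]] : exists2 s, S s & compact_obj s /\ M (s ⊗ b).
  by apply: (Mbig _ a (ideal_colon iM cb) (sub _ cb)).
have [t St [ct Mts]] : exists2 t, S t & compact_obj t /\ M (t ⊗ s).
  apply: (Mbig _ b (ideal_colon iM cs) (sub _ cs)) => //.
  by split=> //; exact: (ideal_sym iM).
have : set0 (t ⊗ s) by rewrite -MS; split=> //; exact: SM.
by [].
Qed.

Lemma csupp_tensor (C D : T) : compact_obj C -> compact_obj D ->
  csupp (C ⊗ D) = csupp C `&` csupp D.
Proof.
move=> cC cD; apply/seteqP; split=> p; rewrite /csupp/=.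
  have [ip _ _] := prime_ofP p => nCD; split=> [pC|pD]; apply: nCD.
    apply: (ideal_sym ip) => //; exact: (ideal_tensor ip).
  exact: (ideal_tensor ip).
move=> [nC nD] pCD.
by have [_ _ /(_ C D cC cD pCD)[]] := prime_ofP p.
Qed.

Lemma csupp_unit : csupp (unit_obj : T) = setT.
Proof.
apply/seteqP; split=> // p _ p1; have [ip [C cC nC] _] := prime_ofP p.
apply: nC; apply: (thick_iso (ideal_thick ip) cC _ (ideal_tensor ip p1 cC)).
by exists (runit C); exact: runit_iso.
Qed.

Lemma open_csuppC (C : T) : compact_obj C -> open (~` csupp C).
Proof.
move=> cC; exists [set ~` csupp C]; last by rewrite bigcup_set1.
move=> _ ->; exists [fset ~` csupp C]%fset => /=.
  by move=> A /fset1P ->; apply/mem_set; exists C.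
by rewrite set_fset1 bigcap_set1.
Qed.

Lemma nbhs_csupp (p : Spc T) (B : set (Spc T)) : nbhs p B ->
  exists2 D : seq T, (forall d, List.In d D -> compact_obj d /\ prime_of p d) &
    forall q, (forall d, List.In d D -> prime_of q d) -> B q.
Proof.
rewrite nbhsE => -[O [oO Op] OB].
have [G GD GO] : exists2 G : set (set (Spc T)),
    G `<=` finI_from [set ~` csupp C | C in @compact_obj T] id &
    \bigcup_(A in G) A = O by [].
move: Op; rewrite -GO => -[A GA Ap].
have [E sE EA] := GD A GA.
suff [D [Dp DE]] : exists D : seq T,
    (forall d, List.In d D -> compact_obj d /\ prime_of p d) /\
    forall q, (forall d, List.In d D -> prime_of q d) ->
      forall U, U \in enum_fset E -> U q.
  exists D => // q Dq; apply: OB; rewrite -GO; exists A => //; rewrite -EA => U /= UE.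
  exact: (DE q Dq).
have Ep U : U \in enum_fset E -> (exists2 C, compact_obj C & ~` csupp C = U) /\ U p.
  move=> UE; split; first by have := sE U UE; rewrite inE.
  by move: Ap; rewrite -EA; apply.
elim: (enum_fset E) Ep => [|U s IH] Ep; first by exists [::].
have [|D [Dp DE]] := IH; first by move=> V Vs; apply: Ep; rewrite inE Vs orbT.
have [[C cC CU] Up] := Ep U (mem_head _ _).
exists (C :: D); split.
  move=> d /= [<-|/Dp //]; split=> //.
  by move: Up; rewrite -CU /csupp /= => /contrapT.
move=> q Dq V; rewrite inE => /orP[/eqP ->|Vs].
  by rewrite -CU /csupp /=; apply; apply: Dq; left.
by apply: DE => // d dD; apply: Dq; right.
Qed.

Lemma compact_csuppC (C : T) : compact_obj C -> compact (~` csupp C).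
Proof.
move=> cC; rewrite compact_ultra => F FF FC.
pose J := [set D : T | compact_obj D /\ csupp D `<=` csupp C].
pose S := [set D : T | compact_obj D /\ F (csupp D)].
have memJ D (p : Spc T) : csupp D `<=` csupp C -> prime_of p C -> prime_of p D.
  by move=> DC pC; apply: contrapT => /DC; exact.
have Jp D : compact_obj D -> (forall p : Spc T, prime_of p C -> prime_of p D) -> J D.
  by move=> cD H; split=> // p pD pC; apply/pD/H.
have iJ : compact_ideal J.
  split; first split.
  - by move=> D [].
  - move=> D cD zD; apply: Jp => // p _; have [[tp _] _ _] := prime_ofP p.
    exact: (thick_zero tp).
  - move=> D E cE DE [_ DC]; apply: Jp => // p pC; have [[tp _] _ _] := prime_ofP p.
    by apply: (thick_iso tp cE DE); exact: memJ pC.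
  - move=> D cD csD; split=> -[_ DC]; apply: Jp => // p pC;
      have [[tp _] _ _] := prime_ofP p;
      apply/(thick_shift tp cD csD); exact: memJ pC.
  - move=> D E G f g h cG d [_ DC] [_ EC]; apply: Jp => // p pC.
    have [[tp _] _ _] := prime_ofP p.
    by apply: (thick_cone tp cG d); exact: memJ pC.
  - move=> D E cD DE [_ EC]; apply: Jp => // p pC; have [[tp _] _ _] := prime_ofP p.
    by apply: (thick_summand tp cD DE); exact: memJ pC.
  - move=> D E [cD DC] cE; apply: Jp => [|p pC]; first exact: compact_tensor.
    by have [[_ op] _ _] := prime_ofP p; apply: op => //; exact: memJ pC.
have [p pC pS] : exists2 p : Spc T, prime_of p C & prime_of p `&` S = set0.
  apply: (prime_exists iJ).
  - by split.
  - by split; [exact: compact_unit|rewrite csupp_unit; exact: filterT].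
  - by move=> D [].
  - move=> D E [cD FD] [cE FE]; split; first exact: compact_tensor.
    by rewrite csupp_tensor//; exact: filterI.
  - apply/seteqP; split=> // D [[_ DC] [_ FD]].
    apply: (@filter_not_empty _ F); apply: filterS (filterI FC FD).
    by move=> q [nqC /DC].
exists p; split; first by apply.
move=> B /nbhs_csupp[D Dp DB].
have : F [set q | forall d, List.In d D -> prime_of q d].
  elim: D Dp {DB} => [|d s IH] Dp; first by apply: (filterS _ filterT) => q _ d [].
  have [cd pd] := Dp d (or_introl erefl).
  have Fd : F (~` csupp d).
    have [Fd|//] := in_ultra_setVsetC (csupp d) FF.
    by have : set0 d by rewrite -pS; split.
  have Fs := IH (fun e es => Dp e (or_intror es)).
  apply: filterS (filterI Fd Fs) => q [/= /contrapT qd qs] e [<-//|].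
  exact: qs.
by apply: filterS => q /DB.
Qed.

Lemma Zset_thomason (p : Spc T) : thomason (Zset p).
Proof.
exists [set ~` csupp C | C in [set C : T | compact_obj C /\ prime_of p C]].
  by move=> _ [C [cC _] <-]; split; [exact: open_csuppC|exact: compact_csuppC].
apply/seteqP; split=> q.
  rewrite /Zset /spec_le /= => /existsNP[B /not_implyP[/nbhs_csupp[D Dp DB]]].
  move=> nqB; have [d [dD nd]] : exists d, List.In d D /\ ~ prime_of q d.
    apply: contrapT => noD; apply: nqB; exists q; split=> //.
    apply: DB => d dD; apply: contrapT => nd; apply: noD.
    by exists d.
  exists (~` csupp d); last by rewrite setCK.
  by exists d => //; exact: Dp.
move=> [_ [C [cC pC] <-]]; rewrite setCK /csupp /= => nqC.
rewrite /Zset /spec_le /= => /(_ (~` csupp C)) [].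
  by apply: open_nbhs_nbhs; split; [exact: open_csuppC|by apply].
by move=> r [-> nr]; exact: nr.
Qed.

End Spectrum.

Definition Lspc (T : rcg_tensor_triangulated) : Type := Spc T.

HB.instance Definition _ (T : rcg_tensor_triangulated) :=
  Choice.copy (Lspc T) (Spc T).
HB.instance Definition _ (T : rcg_tensor_triangulated) :=
  @isSubBaseTopological.Build (Lspc T) (set (Spc T))
    [set A | exists V U : thomasonSet T, A = V `&` ~` U] id.

Section Localisation.
Variable T : rcg_tensor_triangulated.

Definition Tsub (V : set (Spc T)) : set T :=
  smallest (@localising T) [set C | compact_obj C /\ csupp C `<=` V].

Definition is_acyclic (V : set (Spc T)) (X : T) := Tsub V X.

Definition is_local (V : set (Spc T)) (X : T) :=
  forall S, Tsub V S -> forall f : hom S X, f = 0.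

Record localisation_triangle (V : set (Spc T)) := LocalisationTriangle {
  tri_Gamma : endofunctor T;
  tri_L : endofunctor T;
  Gamma_exact : exact_functor tri_Gamma;
  L_exact : exact_functor tri_L;
  Gamma_coproducts : preserves_coproducts tri_Gamma;
  L_coproducts : preserves_coproducts tri_L;
  tri_counit : forall X, hom (tri_Gamma X) (id_functor T X);
  tri_unit : forall X, hom (id_functor T X) (tri_L X);
  tri_bound : forall X, hom (tri_L X) (comp_functor shift tri_Gamma X);
  counit_natural : natural tri_counit;
  unit_natural : natural tri_unit;
  bound_natural : natural tri_bound;
  localisation_dist : forall X,
    dist (tri_counit X) (tri_unit X) (tri_bound X);
  Gamma_acyclic : forall X, is_acyclic V (tri_Gamma X);
  L_local : forall X, is_local V (tri_L X) }.

(* A choice of the functors Gamma_V and L_V for all Thomason subsets V; these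
   are unique up to unique isomorphism. *)
Definition localisation_functors :=
  forall V : thomasonSet T, localisation_triangle V.

Definition loc_tensor (A : set T) : set T :=
  smallest [set S : set T | localising S /\ tensor_ideal S] A.

End Localisation.

Section Support.
Variables (T : rcg_tensor_triangulated) (B : localisation_functors T).

Definition Gamma (V : thomasonSet T) : endofunctor T := tri_Gamma (B V).
Definition Loc (V : thomasonSet T) : endofunctor T := tri_L (B V).

Definition Z (p : Spc T) : thomasonSet T := ThomasonSet (Zset_thomason p).

Definition localise_at (p : Spc T) (X : T) : T := Loc (Z p) X.

Definition Supp (X : T) : set (Spc T) :=
  [set p | ~ is_zero (localise_at p X)].

Definition supp (X : T) : set (Lspc T) :=
  [set p | forall V U : thomasonSet T,
    (V `&` ~` U) p -> ~ is_zero (Gamma V (Loc U X))].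

Definition supp_class (A : set T) : set (Lspc T) := \bigcup_(X in A) supp X.

Definition supportive := forall X : T, supp X = set0 <-> is_zero X.

End Support.

(* Main.v *)
(* Both the V-acyclic and the V-local objects form localising tensor ideals: for
   the latter, compactness gives closure under coproducts and rigidity closure
   under tensoring with compacts. Hence Gamma_V X = Gamma_V 1 ⊗ X and
   L_V X = L_V 1 ⊗ X lie in every localising tensor ideal containing X, in
   particular in the classes {Y | Gamma_W L_U Y = 0}, so that their supports are
   contained in supp X. As supp of an acyclic (local) object lies in V (in V^c),
   supportivity shows that L_V X, Gamma_V X or Gamma_V L_U X vanishes by
   checking that its support is empty. *)

Require Import Defs.

Set Implicit Arguments.
Unset Strict Implicit.
Unset Printing Implicit Defensive.

Import GRing.Theory.
Local Open Scope classical_set_scope.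
Local Open Scope ring_scope.

(** * Isomorphisms, zero objects and coproducts in a preadditive category *)

Section PreadditiveFacts.
Variable C : preadditive.
Implicit Types X Y Z : C.

Lemma compNm X Y Z (g : hom Y Z) (f : hom X Y) : (- g) \c f = - (g \c f).
Proof. by apply/eqP; rewrite -addr_eq0 -compDl addNr comp0m. Qed.

Lemma compmN X Y Z (g : hom Y Z) (f : hom X Y) : g \c (- f) = - (g \c f).
Proof. by apply/eqP; rewrite -addr_eq0 -compDr addNr compm0. Qed.

Lemma compBr X Y Z (g : hom Y Z) (f f' : hom X Y) :
  g \c (f - f') = g \c f - g \c f'.
Proof. by rewrite compDr compmN. Qed.

Lemma iso_lcancel X Y Z (e : hom Y Z) (f g : hom X Y) :
  is_iso e -> e \c f = e \c g -> f = g.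
Proof.
by move=> [e' [ee _]] /(congr1 (comp e')); rewrite !compA ee !comp1m.
Qed.

Lemma iso_rcancel X Y Z (e : hom X Y) (f g : hom Y Z) :
  is_iso e -> f \c e = g \c e -> f = g.
Proof.
by move=> [e' [_ ee]] /(congr1 (comp^~ e')); rewrite -!compA ee !compm1.
Qed.

Lemma iso_comp X Y Z (g : hom Y Z) (f : hom X Y) :
  is_iso g -> is_iso f -> is_iso (g \c f).
Proof.
move=> [g' [gg g'g]] [f' [ff f'f]]; exists (f' \c g').
by rewrite -!compA (compA g') gg comp1m ff (compA f) f'f comp1m g'g.
Qed.

Lemma retract_zero X Y (i : hom X Y) (p : hom Y X) :
  p \c i = idm X -> is_zero Y -> is_zero X.
Proof. by move=> pi zY; apply: id0_zero; rewrite -pi ((zY X).2 i) compm0. Qed.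

Lemma zero_iso X Y : isomorphic X Y -> is_zero X -> is_zero Y.
Proof. by move=> [f [g [_ fg]]]; exact: retract_zero fg. Qed.

Lemma coproduct_retract (I : SmallType) (X : I -> C) P
    (inj : forall i, hom (X i) P) (i : I) :
  is_coproduct inj -> exists p : hom P (X i), p \c inj i = idm (X i).
Proof.
move=> coP.
(* The Kronecker family: the identity at [i], transported along [j = i], and zero elsewhere. *)
pose f j : hom (X j) (X i) :=
  if pselect (j = i) is left e then ecast k (hom (X j) (X k)) e (idm (X j))
  else 0.
have [p [pf _]] := coP _ f; exists p; rewrite pf /f.
by case: pselect => // e; rewrite (Prop_irrelevance e erefl).
Qed.

Lemma coproduct_zero (I : SmallType) (X : I -> C) P
    (inj : forall i, hom (X i) P) :
  is_coproduct inj -> (forall i, is_zero (X i)) -> is_zero P.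
Proof.
move=> coP zX; apply: id0_zero.
have [h [_ uh]] := coP P (fun i => 0).
rewrite -(uh 0) => [|i]; last by rewrite comp0m.
by apply/esym/uh => i; exact: (zX i P).1.
Qed.

End PreadditiveFacts.

(** * Equivalences of categories and compactness *)

Section Equivalences.
Variable C : preadditive.
Implicit Types (X Y Z A : C) (F G : endofunctor C).

Lemma fmor_iso F X Y (f : hom X Y) : is_iso f -> is_iso (fmor F f).
Proof.
by move=> [g [gf fg]]; exists (fmor F g); rewrite -!fmorM gf fg !fmor1.
Qed.

Lemma equiv_inj F X Y (f g : hom X Y) :
  is_equivalence F -> fmor F f = fmor F g -> f = g.
Proof.
move=> [G [_ [b [_ [nb ib]]]]] e; apply: (iso_rcancel (ib X)).
have E (h : hom X Y) : b Y \c fmor G (fmor F h) = h \c b X := nb _ _ h.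
by rewrite -!E e.
Qed.

Lemma equiv_inverse F : is_equivalence F -> exists G, [/\ is_equivalence G,
  forall X, isomorphic (F (G X)) X & forall X, isomorphic (G (F X)) X].
Proof.
move=> [G [a [b [na nb]]]]; exists G; split; first by exists F, b, a.
  by move=> X; exists (a X); exact: na.2.
by move=> X; exists (b X); exact: nb.2.
Qed.

Lemma equiv_full F X Y (h : hom (F X) (F Y)) :
  is_equivalence F -> exists f : hom X Y, fmor F f = h.
Proof.
move=> [G [a [b [na [nb ib]]]]]; have [b' [b'b bb']] := ib X.
exists (b Y \c fmor G h \c b').
have eG : is_equivalence G by exists F, b, a.
apply: (equiv_inj eG); apply: (iso_lcancel (ib Y)).
have E (k : hom X Y) : b Y \c fmor G (fmor F k) = k \c b X := nb _ _ k.
by rewrite E -!compA b'b compm1.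
Qed.

Lemma equiv_inverse_additive F G : is_equivalence F -> additive_functor F ->
  (exists (a : forall X, hom (comp_functor F G X) (id_functor C X)),
    natural_iso a) -> additive_functor G.
Proof.
move=> eF aF [a [na ia]] X Y f g; apply: (equiv_inj eF).
apply: (iso_lcancel (ia Y)); rewrite aF compDr.
have E (h : hom X Y) : a Y \c fmor F (fmor G h) = h \c a X := na _ _ h.
by rewrite !E compDl.
Qed.

(** Up to isomorphism every target is in the image of [F], so a cocone lifts by fullness, and
    uniqueness follows by faithfulness. *)
Lemma equiv_coproducts F : is_equivalence F -> preserves_coproducts F.
Proof.
move=> eF I X P inj coP Y f.
have [G [_ FG _]] := equiv_inverse eF.
have [e [e' [e'e ee']]] := FG Y.
have k_ i := cid (equiv_full (e' \c f i) eF).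
pose k i := sval (k_ i); have kf i : fmor F (k i) = e' \c f i := svalP (k_ i).
have [h [hk uh]] := coP _ k.
exists (e \c fmor F h); split=> [i|h' h'f].
  by rewrite -compA -fmorM hk kf compA ee' comp1m.
have [h0 h0h'] := equiv_full (e' \c h') eF.
rewrite (uh h0) ?h0h' ?compA ?ee' ?comp1m // => i.
by apply: (equiv_inj eF); rewrite fmorM h0h' -compA h'f kf.
Qed.

Lemma fmor_fsum F (I : SmallType) (X : I -> C) A P
    (inj : forall i, hom (X i) P) (g : forall i, hom A (X i)) :
  additive_functor F -> finite_set [set i | g i <> 0] ->
  fmor F (\sum_(i \in [set: {classic I}]) (inj i \c g i)) =
  \sum_(i \in [set: {classic I}]) (fmor F (inj i) \c fmor F (g i)).
Proof.
move=> aF fg; set D : set {classic I} := [set i | g i <> 0].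
have out (V W : C) (H : forall i : {classic I}, hom V W) :
    (forall i, ~ D i -> H i = 0) ->
    \sum_(i \in [set: {classic I}]) H i = \sum_(i \in D) H i.
  by move=> H0; apply/esym/fsbig_widen => // i [_ /H0].
rewrite !out; last 2 first.
- by move=> i /contrapT ->; rewrite fmor0 // compm0.
- by move=> i /contrapT ->; rewrite compm0.
rewrite !fsbig_finite//= (big_morph (fmor F) (id1 := 0) (op1 := +%R)) ?fmor0 //.
by apply: eq_bigr => i _; rewrite fmorM.
Qed.

(** [F] preserves coproducts, so [fmor F f] splits into finitely many components, which lift
    uniquely along the fully faithful [F]. *)
Lemma equiv_compact F A : is_equivalence F -> additive_functor F ->
  compact_obj (F A) -> compact_obj A.
Proof.
move=> eF aF cFA I X P inj coP f.
have [g [[fg sg] ug]] := cFA _ _ _ _ (equiv_coproducts eF coP) (fmor F f).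
have k_ i := cid (equiv_full (g i) eF).
pose k i := sval (k_ i); have kg i : fmor F (k i) = g i := svalP (k_ i).
have fk : finite_set [set i | k i <> 0].
  apply: sub_finite_set fg => i /= k0 g0; apply: k0.
  by apply: (equiv_inj eF); rewrite kg g0 fmor0.
have gk : g = fun i => fmor F (k i).
  by apply: functional_extensionality_dep => i; rewrite kg.
exists k; split; first split=> //.
  by apply: (equiv_inj eF); rewrite sg fmor_fsum // gk.
move=> k' [fk' sk'].
have gk' : g = fun i => fmor F (k' i).
  apply: ug; split; last by rewrite sk' fmor_fsum.
  by apply: sub_finite_set fk' => i /= Fk0 k0; apply: Fk0; rewrite k0 fmor0.
apply: functional_extensionality_dep => i.
by apply: (equiv_inj eF); rewrite kg gk'.
Qed.

End Equivalences.

(** * Exactness of Hom on distinguished triangles *)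

Section Triangles.
Variable T : triangulated.
Implicit Types X Y Z W : T.

Lemma shift_inj X Y (f g : hom X Y) : fmor shift f = fmor shift g -> f = g.
Proof. exact/equiv_inj/shift_equivalence. Qed.

Lemma shift_full X Y (h : hom (shift X) (shift Y)) :
  exists f : hom X Y, fmor shift f = h.
Proof. exact/equiv_full/shift_equivalence. Qed.

Lemma shift_surj X : exists Y, isomorphic (shift Y) X.
Proof.
have [G [_ FG _]] := equiv_inverse (shift_equivalence T).
by exists (G X); exact: FG.
Qed.

Lemma shift0 X Y : fmor shift (0 : hom X Y) = 0.
Proof. exact/fmor0/shift_additive. Qed.

Lemma shift_zero X : is_zero (shift X) <-> is_zero X.
Proof.
split=> [zX|]; last exact/fun_zero/shift_additive.
by apply/id0_zero/shift_inj; rewrite shift0; exact: (zX _).1.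
Qed.

Variables (X Y Z : T) (f : hom X Y) (g : hom Y Z) (h : hom Z (shift X)).
Hypothesis d : dist f g h.

(** Mapping the rotated identity triangle on [W] into the rotated given triangle yields a map
    between shifts, which desuspends to [v]. *)
Lemma dist_lift W (u : hom W Y) : g \c u = 0 -> exists v, u = f \c v.
Proof.
move=> gu; have [Z0 z0] := has_zero T.
have d0 : dist (0 : hom W Z0) (0 : hom Z0 (shift W)) (- fmor shift (idm W)).
  exact: (dist_rotate _ _ _).1 (dist_id W z0).
have e : (0 : hom Z0 Z) \c 0 = g \c u by rewrite gu compm0.
have [c [_]] := dist_mor d0 ((dist_rotate _ _ _).1 d) e.
rewrite fmor1 compmN compm1 compNm => /oppr_inj.
have [v <-] := shift_full c; rewrite -fmorM => /shift_inj.
by exists v.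
Qed.

Lemma dist_extend W (u : hom Y W) : u \c f = 0 -> exists v, u = v \c g.
Proof.
move=> uf; have [Z0 z0] := has_zero T.
have d0 : dist (0 : hom Z0 W) (idm W) (0 : hom W (shift Z0)).
  apply/dist_rotate; rewrite shift0 oppr0; apply: dist_id; exact/shift_zero.
have e : u \c f = 0 \c (0 : hom X Z0) by rewrite uf comp0m.
have [c [cg _]] := dist_mor d d0 e.
by exists c; rewrite cg comp1m.
Qed.

End Triangles.

(** * Closure properties of localising subcategories *)

Section Closure.
Variable T : triangulated.
Implicit Types (X Y Z W : T) (S : set T) (F : endofunctor T).

Lemma dist_zero_iso X Y Z (f : hom X Y) (g : hom Y Z) (h : hom Z (shift X)) :
  dist f g h -> is_zero Z -> is_iso f.
Proof.
move=> d zZ; have [r fr] := dist_lift d ((zZ Y).2 (g \c idm Y)).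
exists r; split; last by rewrite -fr.
apply/eqP; rewrite -subr_eq0; apply/eqP/shift_inj; rewrite shift0.
(* The lift [r] of the identity is a right inverse of [f]; [u] measures the failure on the other
   side, and its shift factors through [Z]. *)
set u := _ - _.
have fu : (- fmor shift f) \c fmor shift u = 0.
  by rewrite compNm -fmorM /u compBr compA -fr comp1m compm1 subrr shift0 oppr0.
have d' := (dist_rotate _ _ _).1 ((dist_rotate _ _ _).1 d).
have [v ->] := dist_lift d' fu.
by rewrite ((zZ _).2 v) compm0.
Qed.

Lemma dist_zero_iso2 X Y Z (f : hom X Y) (g : hom Y Z) (h : hom Z (shift X)) :
  dist f g h -> is_zero X -> is_iso g.
Proof.
by move=> /dist_rotate d zX; apply: (dist_zero_iso d); exact/shift_zero.
Qed.

Section LocalisingClass.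
Variables (S : set T) (locS : localising S).

Lemma localising_zero X : is_zero X -> S X.
Proof. by case: locS => tS _; exact: (thick_zero tS). Qed.

Lemma localising_iso X Y : isomorphic X Y -> S X -> S Y.
Proof. by case: locS => tS _; exact: (thick_iso tS). Qed.

Lemma localising_shift X : S (shift X) <-> S X.
Proof. by case: locS => tS _; exact: (thick_shift tS). Qed.

Lemma localising_cone X Y Z (f : hom X Y) (g : hom Y Z) (h : hom Z (shift X)) :
  dist f g h -> S X -> S Y -> S Z.
Proof. by case: locS => tS _; exact: (thick_cone tS). Qed.

Lemma localising_fiber X Y Z (f : hom X Y) (g : hom Y Z) (h : hom Z (shift X)) :
  dist f g h -> S Y -> S Z -> S X.
Proof.
move=> /dist_rotate d SY SZ; apply/localising_shift.
exact: localising_cone d SY SZ.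
Qed.

Lemma localising_mid X Y Z (f : hom X Y) (g : hom Y Z) (h : hom Z (shift X)) :
  dist f g h -> S X -> S Z -> S Y.
Proof.
move=> /dist_rotate d SX SZ; apply: (localising_fiber d SZ).
exact/localising_shift.
Qed.

End LocalisingClass.

Lemma is_zero_localising : localising (@is_zero T).
Proof.
split; last by move=> I X P inj coP; exact: coproduct_zero coP.
split=> //.
- by move=> X Y _; exact: zero_iso.
- by move=> X _ _; exact: shift_zero.
- move=> X Y Z f g h _ d zX zY; apply: id0_zero.
  have [|v ->] := dist_extend ((dist_rotate _ _ _).1 d) (u := idm Z).
    by rewrite ((zY Z).1 g) compm0.
  by rewrite (((shift_zero _).2 zX _).1 v) comp0m.
- by move=> X Y _ [W [i [_ [p [_ [pi _ _ _ _]]]]]]; exact: retract_zero pi.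
Qed.

Lemma preimage_localising F S : exact_functor F -> preserves_coproducts F ->
  localising S -> localising [set X | S (F X)].
Proof.
move=> [aF [phi [[_ iphi] dphi]]] coF locS; have [tS coS] := locS.
split; last first.
  by move=> I X P inj coP SX; exact: coS (coF _ _ _ _ coP) SX.
have iF X : isomorphic (F (shift X)) (shift (F X)).
  by exists (phi X); exact: iphi.
split=> //.
- by move=> X _ zX; exact/(localising_zero locS)/fun_zero.
- by move=> X Y _ XY; apply: (localising_iso locS); exact: fun_iso.
- move=> X _ _ /=; split=> SX.
    apply/(localising_shift locS); exact: localising_iso (iF X) SX.
  apply: (localising_iso locS (isoS (iF X))); exact/localising_shift.
- by move=> X Y Z f g h _ /dphi d; exact: (localising_cone locS d).
- by move=> X Y _ XY; apply: (thick_summand tS) => //; exact: fun_summand.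
Qed.

Lemma bigcap_localising (I : Type) (D : set I) (S : I -> set T) :
  (forall i, D i -> localising (S i)) -> localising (\bigcap_(i in D) S i).
Proof.
move=> locS; split; last first.
  move=> J X P inj coP SX i Di.
  by apply: (localising_coproduct (locS i Di) coP) => j; exact: SX.
split=> //.
- by move=> X _ zX i /locS locSi; exact: localising_zero.
- by move=> X Y _ XY SX i Di; apply: (localising_iso (locS i Di) XY); exact: SX.
- move=> X _ _; split=> SX i Di; apply/(localising_shift (locS i Di));
    exact: SX.
- move=> X Y Z f g h _ d SX SY i Di.
  by apply: (localising_cone (locS i Di) d); [exact: SX|exact: SY].
- move=> X Y _ XY SY i Di; have [tS _] := locS i Di.
  by apply: (thick_summand tS _ XY) => //; exact: SY.
Qed.

(** Stability of [A] under shifts in both directions allows targets to be desuspended, as closure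
    under shifts and cones requires. *)
Lemma left_perp_localising (A : set T) :
  (forall X Y, isomorphic X Y -> A X -> A Y) ->
  (forall X, A (shift X) <-> A X) ->
  localising [set S | forall X, A X -> forall f : hom S X, f = 0].
Proof.
move=> isoA shA; split; last first.
  move=> I S P inj coP S0 X AX f; have [h [_ uh]] := coP X (fun i => 0).
  rewrite -(uh f) => [|i]; last exact: S0.
  by apply: uh => i; rewrite comp0m.
split=> //.
- by move=> S _ zS X _ f; exact: (zS X).1.
- move=> S S' _ [e [e' [_ ee']]] S0 X AX f.
  by rewrite -(compm1 f) -ee' compA (S0 X AX (f \c e)) comp0m.
- move=> S _ _ /=; split=> S0 X AX f.
    by apply: shift_inj; rewrite shift0; apply: S0; exact/shA.
  have [Y [e [e' [e'e ee']]]] := shift_surj X.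
  have AY : A Y by apply/shA/(isoA X) => //; exists e'; exists e.
  have [g gf] := shift_full (e' \c f).
  by rewrite -(comp1m f) -ee' -compA -gf (S0 Y AY g) shift0 compm0.
- move=> X Y Z f g h _ d X0 Y0 W AW u.
  have [|v ->] := dist_extend ((dist_rotate _ _ _).1 d) (u := u).
    exact: Y0.
  have [W' [e [e' [e'e ee']]]] := shift_surj W.
  have AW' : A W' by apply/shA/(isoA W) => //; exists e'; exists e.
  have [k kv] := shift_full (e' \c v).
  by rewrite -(comp1m v) -ee' -(compA e) -kv (X0 _ AW' k) shift0 compm0 comp0m.
- move=> S S' _ [R [i [_ [p [_ [pi _ _ _ _]]]]]] S0 X AX f.
  by rewrite -(compm1 f) -pi compA (S0 _ AX (f \c p)) comp0m.
Qed.

End Closure.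

(** * Compact objects, acyclic objects and local objects *)

Section Compact.
Variable T : rcg_tensor_triangulated.
Implicit Types (X Y C D : T) (V : set (Spc T)).

Lemma compact_shift C : compact_obj (shift C) <-> compact_obj C.
Proof.
have eS := shift_equivalence T; have aS := @shift_additive T.
split; first exact: equiv_compact eS aS.
have [G [a [b [na nb]]]] := eS => cC.
have eG : is_equivalence G by exists shift, b, a.
have aG : additive_functor G by apply: (equiv_inverse_additive eS aS); exists a.
apply: (equiv_compact eG aG); apply: compact_iso cC.
by apply: isoS; exists (b C); exact: nb.2.
Qed.

Lemma csupp_shift C : compact_obj C -> csupp (shift C) = csupp C.
Proof.
move=> cC; apply/seteqP; split=> p nC pC; apply: nC;
  have [tp _] := prime_is_ideal (prime_ofP p);
  by apply/(thick_shift tp cC) => //; exact/compact_shift.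
Qed.

Lemma csupp_iso C D : compact_obj C -> isomorphic C D -> csupp C = csupp D.
Proof.
move=> cC CD; have cD := compact_iso CD cC.
apply/seteqP; split=> p nC pC; apply: nC;
  have [tp _] := prime_is_ideal (prime_ofP p);
  apply: (thick_iso tp _ _ pC) => //; exact: isoS.
Qed.

Lemma Tsub_localising V : localising (Tsub V).
Proof.
have E : Tsub V = \bigcap_(S in [set S | localising S /\
    [set C : T | compact_obj C /\ csupp C `<=` V] `<=` S]) S by [].
by rewrite E; apply: bigcap_localising => S [].
Qed.

Lemma compact_Tsub V C : compact_obj C -> csupp C `<=` V -> Tsub V C.
Proof. by move=> cC CV S [_]; apply. Qed.

Lemma Tsub_min V (S : set T) : localising S ->
  (forall C, compact_obj C -> csupp C `<=` V -> S C) -> Tsub V `<=` S.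
Proof. by move=> locS KS; apply: smallest_sub => // C []; exact: KS. Qed.

Lemma sub_Tsub V V' : V `<=` V' -> (Tsub V : set T) `<=` Tsub V'.
Proof.
move=> VV; apply: Tsub_min; first exact: Tsub_localising.
by move=> C cC CV; apply: compact_Tsub => //; exact: subset_trans VV.
Qed.

(** The class [A] is shift-stable because the compact generators are, up to isomorphism; its left
    orthogonal is thus localising and contains [Tsub V]. *)
Lemma local_compactP V X : is_local V X <->
  forall C, compact_obj C -> csupp C `<=` V -> forall f : hom C X, f = 0.
Proof.
split=> [lX C cC CV f|lX S]; first exact: lX (compact_Tsub cC CV) f.
pose A := [set X : T | forall C, compact_obj C -> csupp C `<=` V ->
  forall f : hom C X, f = 0].
have isoA Y Y' : isomorphic Y Y' -> A Y -> A Y'.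
  move=> [e [e' [_ ee']]] AY C cC CV f.
  by rewrite -(comp1m f) -ee' -compA (AY C cC CV (e' \c f)) compm0.
have shA Y : A (shift Y) <-> A Y.
  split=> AY C cC CV f.
    apply: shift_inj; rewrite shift0; apply: AY; first exact/compact_shift.
    by rewrite csupp_shift.
  have [D [e [e' [e'e ee']]]] := shift_surj C.
  have cD : compact_obj D.
    by apply/compact_shift; apply: compact_iso cC; exists e'; exists e.
  have [g gf] := shift_full (f \c e).
  rewrite -(compm1 f) -ee' compA -gf (AY D cD _ g) ?shift0 ?comp0m //.
  rewrite -csupp_shift // (@csupp_iso _ C) //; first exact/compact_shift.
  by exists e; exists e'.
move=> TS; apply: (Tsub_min (left_perp_localising isoA shA)) TS X lX.
by move=> C cC CV Y; apply.
Qed.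

Lemma local_localising V : localising (@is_local T V).
Proof.
have locT := Tsub_localising V.
have shL X : is_local V (shift X) <-> is_local V X.
  split=> lX S TS f.
    by apply: shift_inj; rewrite shift0; apply: lX; exact/localising_shift.
  have [R [e [e' [e'e ee']]]] := shift_surj S.
  have TR : Tsub V R.
    apply/(localising_shift locT); apply: localising_iso TS => //.
    by exists e'; exists e.
  have [g gf] := shift_full (f \c e).
  by rewrite -(compm1 f) -ee' compA -gf (lX R TR g) shift0 comp0m.
split; last first.
  move=> I X P inj coP lX; apply/local_compactP => C cC CV f.
  (* A map from a compact object into the coproduct is a finite sum of maps through the summands,
     each of which is zero. *)
  have [g [[_ ->] _]] := cC _ _ _ _ coP f; apply: fsbig1 => i _.
  by rewrite (lX i C (compact_Tsub cC CV) (g i)) compm0.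
split=> //.
- by move=> X _ zX S _ f; exact: (zX S).2.
- move=> X Y _ [e [e' [_ ee']]] lX S TS f.
  by rewrite -(comp1m f) -ee' -compA (lX S TS (e' \c f)) compm0.
- move=> X Y Z f g h _ d lX lY S TS u.
  have [|v ->] := dist_lift ((dist_rotate _ _ _).1 d) (u := u).
    by apply: ((shL X).2 lX).
  by rewrite (lY S TS v) compm0.
- move=> X Y _ [W [i [_ [p [_ [pi _ _ _ _]]]]]] lY S TS f.
  by rewrite -(comp1m f) -pi -compA (lY S TS (i \c f)) compm0.
Qed.

Lemma acyclic_local_zero V X : is_acyclic V X -> is_local V X -> is_zero X.
Proof. by move=> aX lX; apply: id0_zero; exact: lX. Qed.

End Compact.

(** * Localisation triangles and tensor ideals *)

Section Torsion.
Variables (T : rcg_tensor_triangulated) (B : localisation_functors T).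
Implicit Types (X Y C D : T) (V U W : thomasonSet T).

Lemma Gamma_dist V X : exists f g h,
  @dist T (Gamma B V X) X (Loc B V X) f g h.
Proof. by do 3 eexists; exact: (localisation_dist (B V) X). Qed.

Lemma Gamma_in_Tsub V X : Tsub V (Gamma B V X).
Proof. exact: Gamma_acyclic. Qed.

Lemma Loc_local V X : is_local V (Loc B V X).
Proof. exact: L_local. Qed.

Lemma acyclicP V X : is_acyclic V X <-> is_zero (Loc B V X).
Proof.
have [f [g [h d]]] := Gamma_dist V X; have locT := Tsub_localising (T := T) V.
have aG := @Gamma_in_Tsub V X.
split=> [aX|zL].
  apply: (@acyclic_local_zero _ V); last exact: Loc_local.
  exact: (localising_cone locT d).
apply: (localising_mid locT d aG); exact: localising_zero.
Qed.

Lemma localP V X : is_local V X <-> is_zero (Gamma B V X).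
Proof.
have [f [g [h d]]] := Gamma_dist V X; have locL := local_localising (T := T) V.
have lL := @Loc_local V X.
split=> [lX|zG].
  apply: (@acyclic_local_zero _ V); first exact: Gamma_in_Tsub.
  exact: (localising_fiber locL d).
apply: (localising_mid locL d) => //; exact: localising_zero.
Qed.

Lemma acyclic_iso V X : is_acyclic V X -> isomorphic (Gamma B V X) X.
Proof.
move=> /acyclicP zL; have [f [g [h d]]] := Gamma_dist V X.
by exists f; exact: dist_zero_iso d zL.
Qed.

Lemma local_iso V X : is_local V X -> isomorphic X (Loc B V X).
Proof.
move=> /localP zG; have [f [g [h d]]] := Gamma_dist V X.
by exists g; exact: dist_zero_iso2 d zG.
Qed.

(** Gamma kills [L] and the localisation kills [A], so each functor turns one map of the triangle
    into an isomorphism. *)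
Lemma torsion_triangle_unique V (A X L : T) f g h : @dist T A X L f g h ->
  is_acyclic V A -> is_local V L ->
  isomorphic (Gamma B V X) A /\ isomorphic (Loc B V X) L.
Proof.
move=> d aA lL.
have [_ [phi [_ /(_ _ _ _ _ _ _ d) dG]]] := Gamma_exact (B V).
have [_ [psi [_ /(_ _ _ _ _ _ _ d) dL]]] := L_exact (B V).
have iG := dist_zero_iso dG ((localP _ _).1 lL).
have iL := dist_zero_iso2 dL ((acyclicP _ _).1 aA).
split.
  apply: isoT (acyclic_iso aA); apply: isoS; by eexists; exact: iG.
by apply: isoT (isoS (local_iso lL)); eexists; exact: iL.
Qed.

Lemma thomasonT : thomason [set: Spc T].
Proof.
exists [set set0]; first by move=> _ ->; split; [exact: open0|exact: compact0].
by rewrite bigcup_set1 setC0.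
Qed.

Lemma thomason0 : thomason (set0 : set (Spc T)).
Proof. by exists set0 => //; rewrite bigcup_set0. Qed.

(** The whole and the empty set serve as neutral entries for [V] and [U] when a test pair concerns
    only one of the two functors. *)
Definition thomT := ThomasonSet thomasonT.
Definition thom0 := ThomasonSet thomason0.

Lemma iter_shift_localising (S : set T) n X :
  localising S -> S X -> S (iter n shift X).
Proof. by move=> locS SX; elim: n => //= n IH; exact/localising_shift. Qed.

(** The localisation of [X] at the whole spectrum admits no nonzero map from a generator or its
    shifts, so compact generation makes it vanish. *)
Lemma Tsub_setT X : Tsub [set: Spc T] X.
Proof.
apply/(acyclicP thomT).
have [J [G [cG]]] := compact_generation T; apply=> j n.
have lL := @Loc_local thomT X.
have TG : Tsub [set: Spc T] (G j) by exact: compact_Tsub.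
split=> f.
  by apply: lL; exact: (iter_shift_localising n (Tsub_localising _) TG).
exact: (iter_shift_localising n (local_localising _) lL) _ TG f.
Qed.

Lemma localising_compact (S : set T) : localising S ->
  (forall C, compact_obj C -> S C) -> forall X, S X.
Proof.
by move=> locS cS X; apply: (Tsub_min locS _ (Tsub_setT X)) => C /cS.
Qed.

Lemma tensorl_localising (S : set T) Y :
  localising S -> localising [set X | S (Y ⊗ X)].
Proof.
exact: (preimage_localising (tensorl_exact Y) (@tensorl_coproducts T Y)).
Qed.

Lemma tensorr_localising (S : set T) Y :
  localising S -> localising [set X | S (X ⊗ Y)].
Proof.
exact: (preimage_localising (tensorr_exact Y) (@tensorr_coproducts T Y)).
Qed.

(** For fixed [X] in [S], the objects [Y] with [Y ⊗ X] in [S] form a localising subcategory, so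
    compact [Y] suffice. *)
Lemma compact_tensor_ideal (S : set T) : localising S ->
  (forall C X, compact_obj C -> S X -> S (C ⊗ X)) -> tensor_ideal S.
Proof.
move=> locS cS X Y SX; move: Y.
by apply: (localising_compact (tensorr_localising X locS)) => C cC; exact: cS.
Qed.

Lemma Tsub_ideal (V : set (Spc T)) : @tensor_ideal T (Tsub V).
Proof.
have locT := Tsub_localising (T := T) V.
apply: (compact_tensor_ideal locT) => D X cD.
apply: (Tsub_min (tensorl_localising D locT)) => C cC CV /=.
apply: compact_Tsub; first exact: compact_tensor.
by rewrite csupp_tensor //; apply: subset_trans CV => p [].
Qed.

(** The coevaluation is the transpose of [lunit C] pulled back along the isomorphism [nu]; the
    equation is a triangle identity of duality. *)
Lemma dualisable_coev C : compact_obj C ->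
  exists eta : hom unit_obj (C ⊗ ihom C unit_obj),
    runit C \c tmor (idm C) (eval C unit_obj) \c assoc C (ihom C unit_obj) C
      \c tmor eta (idm C) = lunit C.
Proof.
move=> cC; have [nu nuE [nu' [_ nunu']]] := compact_rigid cC C.
have [g [gE _]] := eval_universal (lunit C).
exists (nu' \c g); rewrite -nuE -gE -compA; congr (_ \c _).
by rewrite -tmorM compA nunu' comp1m compm1.
Qed.

Lemma inverse_iso X Y (e : hom X Y) (e' : hom Y X) :
  e' \c e = idm X -> e \c e' = idm Y -> is_iso e'.
Proof. by move=> ee e'e; exists e. Qed.

(* The triangle identity makes D ⊗ - a retract of D ⊗ D^* ⊗ D ⊗ -, so a map
   S -> D ⊗ X vanishes as soon as its transpose D^* ⊗ S -> X does. *)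
Lemma local_ideal (V : set (Spc T)) : @tensor_ideal T (is_local V).
Proof.
apply: (compact_tensor_ideal (local_localising V)) => D X cD lX S TS f.
have [eta etaE] := dualisable_coev cD; set D' := ihom D unit_obj in eta etaE *.
have [a1 [a1K Ka1]] := assoc_iso D' D X.
have [a2 [a2K Ka2]] := assoc_iso unit_obj D X.
pose ev := tmor (eval D unit_obj) (idm X) \c a1.
(* [k] is the triangle composite on [D]; [m] is its analogue on [D ⊗ X], bracketed so that [ev] acts
   last. *)
pose k := tmor (idm D) (eval D unit_obj) \c assoc D D' D \c tmor eta (idm D).
pose m := tmor (idm D) ev \c assoc D D' (D ⊗ X) \c tmor eta (idm (D ⊗ X)).
have ik : is_iso k.
  have [r [rK Kr]] := runit_iso D; have -> : k = r \c lunit D.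
    by rewrite -etaE /k !compA rK comp1m.
  by apply: iso_comp (lunit_iso D); exact: inverse_iso Kr.
(* Naturality of [assoc] and the pentagon reduce [m] to [k] tensored with [X]. *)
have mE : m \c assoc unit_obj D X = assoc D unit_obj X \c tmor k (idm X).
  have n1 := assoc_natural eta (idm D) (idm X); rewrite tmor1 in n1.
  have n2 : assoc D unit_obj X \c tmor (tmor (idm D) (eval D unit_obj)) (idm X)
      = tmor (idm D) (tmor (eval D unit_obj) (idm X)) \c assoc D (D' ⊗ D) X.
    exact: assoc_natural.
  rewrite /m -!compA -n1 (compA (assoc _ _ _)) -pentagon /ev tensorlM.
  rewrite -!compA (compA (tmor (idm D) a1)) -tensorlM a1K tmor1 comp1m.
  by rewrite (compA (tmor (idm D) (tmor _ _))) -n2 -!compA /k !tensorrM -!compA.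
have im : is_iso m.
  have -> : m = assoc D unit_obj X \c tmor k (idm X) \c a2.
    by rewrite -mE -compA Ka2 compm1.
  apply: iso_comp; last exact: inverse_iso Ka2.
  by apply: iso_comp (assoc_iso _ _ _) _; exact: (fmor_iso (tensorr X) ik).
(* After [lunit X] this is a map from the acyclic [D' ⊗ S] to the local [X]. *)
have evf : ev \c tmor (idm D') f = 0.
  apply: (iso_lcancel (lunit_iso X)); rewrite compm0.
  by apply: (lX (D' ⊗ S)); exact: Tsub_ideal.
have mf : m \c tmor (idm unit_obj) f = 0.
  have n := assoc_natural (idm D) (idm D') f.
  rewrite tmor1 in n.
  rewrite /m -!compA -tmorM comp1m compm1 -(comp1m eta) -(compm1 f) tmorM.
  rewrite (compA (assoc _ _ _)) n !compA -tensorlM evf.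
  have [aD _] := tensorl_exact D.
  have -> : tmor (idm D) (0 : hom (D' ⊗ S) (unit_obj ⊗ X)) = 0.
    exact: fmor0 aD.
  by rewrite !comp0m.
have f0 : tmor (idm unit_obj) f = 0.
  by apply: (iso_lcancel im); rewrite mf compm0.
by apply: (iso_rcancel (lunit_iso S)); rewrite -lunit_natural f0 compm0 comp0m.
Qed.

Lemma ideal_Gamma_Loc (S : set T) V X : localising S -> tensor_ideal S ->
  S X -> S (Gamma B V X) /\ S (Loc B V X).
Proof.
move=> locS idS SX; have [f [g [h d]]] := Gamma_dist V unit_obj.
have [_ [phi [_ /(_ _ _ _ _ _ _ d) dX]]] := tensorr_exact X.
have locT := Tsub_localising (T := T) V.
have iX : isomorphic (unit_obj ⊗ X) X by eexists; exact: lunit_iso.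
(* [tensor_ideal] multiplies on the left, so the braiding moves [X] to the right. *)
have aA : is_acyclic V (Gamma B V unit_obj ⊗ X).
  have := Tsub_ideal X (@Gamma_in_Tsub V unit_obj).
  apply: (localising_iso locT); eexists; exists (braid _ _).
  by split; exact: braid_sym.
have lL : is_local V (Loc B V unit_obj ⊗ X).
  have := @local_ideal V _ X (@Loc_local V unit_obj).
  apply: (localising_iso (local_localising V)); eexists; exists (braid _ _).
  by split; exact: braid_sym.
have [iG iL] := torsion_triangle_unique dX aA lL.
split; apply: (localising_iso locS).
- exact: isoT (isoS iG) (fun_iso (Gamma B V) iX).
- exact: idS.
- exact: isoT (isoS iL) (fun_iso (Loc B V) iX).
- exact: idS.
Qed.

(** The support of [X] omits [p] exactly when [X] lies in such a class with [p] in [V] and outside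
    [U]. *)
Definition killed V U := [set X : T | is_zero (Gamma B V (Loc B U X))].

Lemma killedP V U X : killed V U X <-> is_local V (Loc B U X).
Proof. exact: iff_sym (localP V _). Qed.

Lemma killed_localising V U : localising (killed V U).
Proof.
have coG := Gamma_coproducts (l := B V); have coL := L_coproducts (l := B U).
have loc0 := @is_zero_localising T.
have locG := preimage_localising (Gamma_exact (B V)) coG loc0.
exact: preimage_localising (L_exact (B U)) coL locG.
Qed.

(** By uniqueness of triangles [Loc B U (Y ⊗ X)] is isomorphic to [Y ⊗ Loc B U X], and local objects
    absorb [Y]. *)
Lemma killed_ideal V U : tensor_ideal (killed V U).
Proof.
move=> X Y /killedP lX; apply/killedP.
have [f [g [h d]]] := Gamma_dist U X.
have [_ [phi [_ /(_ _ _ _ _ _ _ d) dY]]] := tensorl_exact Y.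
have [_ iL] := torsion_triangle_unique dY
  (@Tsub_ideal U _ Y (@Gamma_in_Tsub U X))
  (@local_ideal U _ Y (@Loc_local U X)).
by apply: (localising_iso (local_localising V) (isoS iL)); exact: local_ideal.
Qed.

End Torsion.

(** * Thomason subsets and a basis of the localising topology *)

Section LocalisingTopology.
Variable T : rcg_tensor_triangulated.
Implicit Types V U : thomasonSet T.

Lemma thomasonU (V U : set (Spc T)) :
  thomason V -> thomason U -> thomason (V `|` U).
Proof.
move=> [F Fo ->] [G Go ->]; exists (F `|` G); first by move=> O [/Fo|/Go].
by rewrite bigcup_setU.
Qed.

Lemma thomasonI (V U : set (Spc T)) :
  thomason V -> thomason U -> thomason (V `&` U).
Proof.
move=> [F Fo ->] [G Go ->].
exists [set O | exists O1 O2, [/\ F O1, G O2 & O = O1 `|` O2]].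
  move=> _ [O1 [O2 [/Fo[oO1 cO1] /Go[oO2 cO2] ->]]].
  by split; [exact: openU|exact: compactU].
apply/seteqP; split=> p.
  by move=> [[O1 FO1 pO1] [O2 GO2 pO2]]; exists (O1 `|` O2);
    [exists O1, O2|rewrite setCU].
by move=> [_ [O1 [O2 [FO1 GO2 ->]]]]; rewrite setCU => -[pO1 pO2];
  split; [exists O1|exists O2].
Qed.

(** Thomason subsets are stable under specialisation: an open set around [p] contains every [q]
    having [p] in its closure. *)
Lemma thomason_sub_Zset V (p : Spc T) : ~ tset V p -> V `<=` Zset p.
Proof.
case: V => V /= [F Fo VF] nVp q Vq qp; apply: nVp.
move: Vq; rewrite VF => -[O FO nOq]; exists O => // Op.
have [oO _] := Fo O FO.
by have [_ [-> /nOq]] := qp O (open_nbhs_nbhs (conj oO Op)).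
Qed.

Lemma Zset_refl (p : Spc T) : ~ Zset p p.
Proof. by apply; exact: subset_closure. Qed.

Lemma open_basic V U : open (V `&` ~` U : set (Lspc T)).
Proof.
set A : set (Lspc T) := V `&` ~` U.
exists [set A]; last by rewrite bigcup_set1.
move=> _ ->; exists [fset A]%fset => /=; last by rewrite set_fset1 bigcap_set1.
by move=> A' /fset1P ->; apply/mem_set; exists V, U.
Qed.

(** The generating sets are closed under finite intersections, by intersecting the [V] and uniting
    the [U]; the pair [thomT], [thom0] gives the empty intersection. *)
Lemma nbhs_basic (p : Lspc T) (O : set (Lspc T)) : nbhs p O ->
  exists V U, (V `&` ~` U) p /\ V `&` ~` U `<=` O.
Proof.
rewrite nbhsE => -[O' [oO' O'p] O'O].
have [G GD GO] : exists2 G : set (set (Lspc T)),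
    G `<=` finI_from [set A : set (Lspc T) | exists V U, A = V `&` ~` U] id &
    \bigcup_(A in G) A = O' by [].
move: O'p; rewrite -GO => -[A GA Ap].
have [E sE EA] := GD A GA.
suff [V [U [VUp VUE]]] : exists V U, (V `&` ~` U) p /\
    forall q, (V `&` ~` U) q -> forall W, W \in enum_fset E -> W q.
  exists V, U; split=> // q VUq; apply: O'O; rewrite -GO; exists A => //.
  by rewrite -EA => W WE; exact: VUE VUq _ WE.
have {EA sE Ap} Ep W : W \in enum_fset E -> (exists V U, W = V `&` ~` U) /\ W p.
  move=> WE; split; first by have := sE W WE; rewrite inE.
  by move: Ap; rewrite -EA; apply.
elim: (enum_fset E) Ep => [|W s IH] Ep.
  by exists (thomT T), (thom0 T); split=> //; split.
have [|V [U [[Vp Up] VUs]]] := IH.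
  by move=> W' Ws; apply: Ep; rewrite inE Ws orbT.
have [[V' [U' WE]] Wp] := Ep W (mem_head _ _).
rewrite WE in Wp; case: Wp => V'p U'p.
exists (ThomasonSet (thomasonI (tsetP V') (tsetP V))).
exists (ThomasonSet (thomasonU (tsetP U') (tsetP U))).
split; first by split=> // -[].
move=> q [[V'q Vq] /= /not_orP[U'q Uq]] W'; rewrite inE => /orP[/eqP ->|].
  by rewrite WE.
exact: VUs.
Qed.

Lemma closure_basicP (A : set (Lspc T)) (p : Lspc T) : closure A p <->
  forall V U, (V `&` ~` U) p -> exists2 q, A q & (V `&` ~` U) q.
Proof.
split=> [cA V U VUp|cA O /nbhs_basic[V [U [VUp VUO]]]].
  have [q [Aq VUq]] := cA _ (open_nbhs_nbhs (conj (open_basic V U) VUp)).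
  by exists q.
by have [q Aq /VUO Oq] := cA V U VUp; exists q.
Qed.

End LocalisingTopology.

(** * Supports of acyclic, local and generated objects *)

Section Support.
Variables (T : rcg_tensor_triangulated) (B : localisation_functors T).
Implicit Types (X Y : T) (V U W : thomasonSet T).

Lemma not_suppP X (p : Lspc T) : ~ supp B X p <->
  exists V U, (V `&` ~` U) p /\ killed B V U X.
Proof.
split=> [/existsNP[V /existsNP[U /not_implyP[VUp /contrapT kX]]]|].
  by exists V, U.
by move=> [V [U [VUp kX]]] /(_ V U VUp).
Qed.

Lemma supp_sub X Y :
  (forall S, localising S -> tensor_ideal S -> S X -> S Y) ->
  supp B Y `<=` supp B X.
Proof.
move=> XY p; apply: contraPP => /not_suppP[V [U [VUp kX]]]; apply/not_suppP.
exists V, U; split=> //.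
exact: XY (killed_localising B V U) (@killed_ideal T B V U) kX.
Qed.

Lemma supp_Gamma X V : supp B (Gamma B V X) `<=` supp B X.
Proof. by apply: supp_sub => S lS iS /(ideal_Gamma_Loc B V lS iS)[]. Qed.

Lemma supp_Loc X V : supp B (Loc B V X) `<=` supp B X.
Proof. by apply: supp_sub => S lS iS /(ideal_Gamma_Loc B V lS iS)[]. Qed.

Lemma supp_acyclic V X : is_acyclic V X -> supp B X `<=` V.
Proof.
move=> /(acyclicP B) zL p sXp; apply: contrapT => nVp; move: sXp.
apply/not_suppP; exists (thomT T), V; split; first by split.
by apply: fun_zero zL; have [] := Gamma_exact (B (thomT T)).
Qed.

Lemma local_empty V X : is_local V X -> is_local (thom0 T) X.
Proof.
move=> lX S TS; apply: lX; apply: (sub_Tsub _ TS).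
by rewrite /thom0 /=; exact: sub0set.
Qed.

Lemma supp_local V X : is_local V X -> supp B X `<=` ~` V.
Proof.
move=> lX p sXp Vp; move: sXp; apply/not_suppP.
(* Localising at the empty set leaves the [V]-local [X] unchanged up to isomorphism. *)
exists V, (thom0 T); split; first by split=> // -[].
apply/killedP; apply: (localising_iso (local_localising V) _ lX).
exact/local_iso/(local_empty lX).
Qed.

Lemma supp_sub_Supp X : supp B X `<=` Supp B X.
Proof.
move=> p sXp; rewrite /Supp /localise_at => zX; move: sXp; apply/not_suppP.
(* [Z p] misses [p], so the whole space and [Z p] form an admissible pair at [p]. *)
exists (thomT T), (Z p); split; first by split=> //; exact: Zset_refl.
by apply: fun_zero zX; have [] := Gamma_exact (B (thomT T)).
Qed.

Hypothesis hT : supportive B.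

Lemma supp_empty_zero X : supp B X `<=` set0 -> is_zero X.
Proof. by rewrite subset0 => sX; exact: (hT X).1. Qed.

Lemma supp_sub_acyclic V X : supp B X `<=` V -> is_acyclic V X.
Proof.
move=> sXV; apply/(acyclicP B); apply: supp_empty_zero => p sp.
by apply: (supp_local (@Loc_local T B V X) sp); apply/sXV/supp_Loc/sp.
Qed.

Lemma supp_sub_local V X : supp B X `<=` ~` V -> is_local V X.
Proof.
move=> sXV; apply/(localP B); apply: supp_empty_zero => p sp.
apply: sXV (supp_acyclic (@Gamma_in_Tsub T B V X) sp).
exact: supp_Gamma sp.
Qed.

(** The support of [Gamma B V (Loc B U X)] lies in [V], outside [U] and within [supp B X]; if these
    have no common point, supportivity applies. *)
Lemma killed_suppP V U X :
  V `&` ~` U `&` supp B X = set0 <-> killed B V U X.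
Proof.
split=> [VUX|kX]; last first.
  by apply/seteqP; split=> // p [VUp /(_ V U VUp)].
apply: supp_empty_zero => p sp; rewrite -VUX; split; last first.
  exact: supp_Loc (supp_Gamma sp).
split; first exact: (supp_acyclic (@Gamma_in_Tsub T B V _) sp).
(* The [U]-local objects form a localising tensor ideal, so Gamma preserves them. *)
have idU := local_ideal B (V := U).
have lU : is_local U (Gamma B V (Loc B U X)).
  have lLU := @Loc_local T B U X.
  exact: (ideal_Gamma_Loc B V (local_localising U) idU lLU).1.
exact: (supp_local lU sp).
Qed.

(** For [p] outside [V], maximality of [Z p] makes acyclic objects vanish at [p]; conversely [supp]
    lies in [Supp]. *)
Lemma Tsub_Supp V : Tsub V = [set X : T | Supp B X `<=` V].
Proof.
apply/seteqP; split=> X.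
  move=> aX p nz; apply: contrapT => nVp; apply: nz.
  by apply/acyclicP; apply: sub_Tsub aX; exact: thomason_sub_Zset.
move=> sX; apply: supp_sub_acyclic.
exact: subset_trans (@supp_sub_Supp X) sX.
Qed.

Lemma loc_tensor_min (A S : set T) : localising S -> tensor_ideal S ->
  A `<=` S -> loc_tensor A `<=` S.
Proof. by move=> lS iS AS; exact: smallest_sub. Qed.

(** A basic neighbourhood missing the supports of [A] gives a killed class containing [A], hence all
    of [loc_tensor A]. *)
Lemma supp_loc_tensor (A : set T) (X : T) : loc_tensor A X ->
  supp B X `<=` closure (supp_class B A : set (Lspc T)).
Proof.
move=> AX p sXp; apply/closure_basicP => V U VUp; apply: contrapT => noq.
apply: (sXp V U VUp).
apply: (loc_tensor_min (killed_localising B V U) (@killed_ideal T B V U) _ AX).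
move=> Y AY; apply/killed_suppP/seteqP; split=> // q [VUq sYq].
by apply: noq; exists q => //; exists Y.
Qed.

Lemma loc_tensor_localising (A : set T) : localising (loc_tensor A).
Proof.
have E : loc_tensor A = \bigcap_(S in [set S : set T |
    (localising S /\ tensor_ideal S) /\ A `<=` S]) S by [].
by rewrite E; apply: bigcap_localising => S [[]].
Qed.

Lemma supp_coproduct (I : SmallType) (X : I -> T) (P : T)
    (inj : forall i, hom (X i) P) : is_coproduct inj ->
  closure (\bigcup_i supp B (X i) : set (Lspc T)) `<=` supp B P.
Proof.
move=> coP p /closure_basicP cl V U VUp kP.
have [q [i _ sq] VUq] := cl V U VUp.
(* A summand is a retract of [P], so vanishing passes from [P] to it. *)
have [r ri] := coproduct_retract i coP; apply: (sq V U VUq).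
apply: (retract_zero (i := fmor (Gamma B V) (fmor (Loc B U) (inj i)))
  (p := fmor (Gamma B V) (fmor (Loc B U) r))) kP.
by rewrite -!fmorM ri !fmor1.
Qed.

End Support.

(** * Small coproducts and closures of supports *)

Section Smallness.
Variable T : rcg_tensor_triangulated.

(* A prime is determined by which members of a small skeleton of T^c it
   contains; this makes the coproduct over all pairs of Thomason subsets below
   small, although the class A need not be. *)
Lemma Spc_subsets_small : exists (K : SmallType) (c : K -> set (Spc T)),
  forall A, exists k, c k = A.
Proof.
have [J [E EP]] := compact_small T.
pose tr (p : Spc T) : J -> Prop := fun j => prime_of p (E j).
have tr_sub p q X : tr p = tr q -> prime_of p X -> prime_of q X.
  move=> tpq pX; have [tp _] := prime_is_ideal (prime_ofP p).
  have [tq _] := prime_is_ideal (prime_ofP q).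
  have cX := thick_sub tp pX; have [j jX] := EP X cX.
  apply: (thick_iso tq cX jX); rewrite -[prime_of q _]/(tr q j) -tpq.
  exact: (thick_iso tp (compact_iso (isoS jX) cX) (isoS jX)).
have tr_inj p q : tr p = tr q -> p = q.
  move=> tpq; have : prime_of p = prime_of q.
    by apply/seteqP; split=> X; apply: tr_sub.
  case: p {tpq} => P hP; case: q => Q hQ /= PQ; case: _ / PQ in hQ *.
  by rewrite (Prop_irrelevance hP hQ).
(* A set of points is coded by the traces of its primes on the skeleton. *)
exists ((J -> Prop) -> Prop), (fun k => [set p | k (tr p)]) => A.
exists (fun t => exists2 p, A p & t = tr p).
apply/seteqP; split=> p /=; last by exists p.
by move=> [q Aq /tr_inj ->].
Qed.

Variable B : localisation_functors T.
Hypothesis hT : supportive B.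

(** For each pair of sets, an object of [A] whose support meets their difference is chosen if there
    is one; the coproduct of these has every closure point in its support. *)
Lemma closure_supp_class (A : set T) :
  closure (supp_class B A : set (Lspc T)) `<=` supp_class B (loc_tensor A).
Proof.
move=> p /closure_basicP cl; have [K [c cP]] := Spc_subsets_small.
have [Z0 z0] := has_zero T.
pose good k l X := A X /\ exists2 q, supp B X q & (c k `&` ~` c l) q.
(* Pairs without a suitable object get the default [Z0], which lies in every localising
   subcategory. *)
pose X (i : K * K) := if pselect (exists X, good i.1 i.2 X) is left e
  then sval (cid e) else Z0.
have [P [inj coP]] := has_coproducts X.
have locA := loc_tensor_localising A.
exists P.
  apply: (localising_coproduct locA coP) => i; rewrite /X.
  case: pselect => [e|_]; last exact: localising_zero.
  by have [AY _] := svalP (cid e) => S [_]; apply.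
apply: (supp_coproduct coP); apply/closure_basicP => V U VUp.
have [k kV] := cP V; have [l lU] := cP U.
have [q [Y AY sq] VUq] := cl V U VUp.
have e : exists Y, good k l Y.
  by exists Y; split=> //; exists q; rewrite // kV lU.
have [AX [q' sq' VUq']] : good k l (X (k, l)).
  by rewrite /X; case: pselect => // e'; exact: svalP (cid e').
by exists q'; [exists (k, l)|rewrite -kV -lU].
Qed.

End Smallness.

(** * The five consequences of supportivity *)

Theorem theorem4p7 (T : rcg_tensor_triangulated) (B : localisation_functors T)
    (hT : supportive B) :
  (* (1) *)
  (forall V : thomasonSet T,
    [/\ forall X : T, is_acyclic V X <-> supp B X `<=` V,
        forall X : T, is_local V X <-> supp B X `<=` ~` V
      & Tsub V = [set X : T | Supp B X `<=` V]]) /\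
  (* (2) *)
  (forall S X : T,
    (exists V : thomasonSet T, supp B S `<=` V /\ V `&` supp B X = set0) ->
    forall f : hom S X, f = 0%R) /\
  (* (3) *)
  (forall (V U : thomasonSet T) (X : T),
    V `&` ~` U `&` supp B X = set0 <-> is_zero (Gamma B V (Loc B U X))) /\
  (* (4) *)
  (forall A : set T,
    supp_class B (loc_tensor A) = closure (supp_class B A : set (Lspc T))) /\
  (forall (I : SmallType) (X : I -> T) (P : T) (inj : forall i, hom (X i) P),
    is_coproduct inj ->
    supp B P = closure (\bigcup_i supp B (X i) : set (Lspc T))) /\
  (* (5) *)
  (forall A : set (Lspc T), closed A ->
    localising [set X : T | supp B X `<=` A]).
Proof.
split.
  move=> V; split; last exact: Tsub_Supp.
    by move=> X; split; [exact: supp_acyclic|exact: supp_sub_acyclic].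
  by move=> X; split; [exact: supp_local|exact: supp_sub_local].
split.
  move=> S X [V [SV VX]]; apply: (supp_sub_local hT _ (supp_sub_acyclic hT SV)).
  by apply/disjoints_subset; rewrite setIC.
split; first exact: killed_suppP.
split.
  move=> A; apply/seteqP; split; last exact: closure_supp_class.
  by move=> p [X /(supp_loc_tensor hT)]; apply.
split.
  move=> I X P inj coP; apply/seteqP; split; last exact: supp_coproduct.
  have aP : loc_tensor (range X) P.
    apply: (localising_coproduct (loc_tensor_localising _) coP) => i S [_].
    by apply; exists i.
  apply: subset_trans (supp_loc_tensor hT aP) _; apply: closure_subset.
  by move=> p [_ [i _ <-] sp]; exists i.
move=> A cA.
(* The complement of a closed set is a union of basic open sets, so the class is an intersection of
   localising classes [killed]. *)
have -> : [set X : T | supp B X `<=` A] =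
    \bigcap_(VU in [set VU : thomasonSet T * thomasonSet T |
      VU.1 `&` ~` VU.2 `<=` ~` A]) killed B VU.1 VU.2.
  apply/seteqP; split=> X.
    move=> sXA [V U] /= VUA; apply/(killed_suppP hT)/seteqP.
    by split=> // p [/VUA nAp /sXA].
  move=> kX p sXp; apply: cA; apply/closure_basicP => V U VUp.
  apply: contrapT => nq; apply: (sXp V U VUp); apply: (kX (V, U)) => q VUq Aq.
  by apply: nq; exists q.
by apply: bigcap_localising => -[V U] _; exact: killed_localising.
Qed.
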